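(* Let $k$ be a positive integer. If a signed graph $(G,\sigma)$ is $(12k-1)$-edge connected and essentially $(2k+1)$-unbalanced, then $\Phi_c(G,\sigma)\le 2+\frac1k$.
   Context: A signed graph is a pair $(G,\sigma)$ where $G$ is a graph and $\sigma:E(G)\to\{1,-1\}$; edges with $\sigma(e)=1$ are positive, those with $\sigma(e)=-1$ negative. An orientation $\tau$ of $(G,\sigma)$ orients each positive edge $e=xy$ from one end to the other (if from $x$ to $y$, then $e\in E^+_\tau(x)\cap E^-_\tau(y)$), and labels each negative edge $e=xy$ either as a sink edge, with $e\in E^+_\tau(x)\cap E^+_\tau(y)$, or as a source edge, with $e\in E^-_\tau(x)\cap E^-_\tau(y)$. A circulation is an orientation $\tau$ together with a map $f:E(G)\to\mathbb{R}$. Its boundary is $\partial f(v)=\sum_{e\in E^+_\tau(v)}f(e)-\sum_{e\in E^-_\tau(v)}f(e)$. A flow is a circulation with $\partial f\equiv 0$. For a real $r$, a circular $r$-flow is a flow with $1\le |f(e)|\le r-1$ for every edge $e$. The circular flow number $\Phi_c(G,\sigma)$ is the least $r$ such that $(G,\sigma)$ admits a circular $r$-flow, and it is $\infty$ if no such flow exists. Switching at a vertex $v$ negates the sign of every edge incident to $v$. Two signed graphs on the same underlying graph are equivalent if one is obtained from the other by a sequence of switchings. $(G,\sigma)$ is essentially $(2k+1)$-unbalanced if every signed graph equivalent to it has either an even number of negative edges or at least $2k+1$ negative edges. Edge connectivity refers to the underlying graph $G$. *)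

(* Defs.v *)
From mathcomp Require Import all_boot all_order all_algebra.
From mathcomp Require Import reals.
Set Implicit Arguments. Unset Strict Implicit. Unset Printing Implicit Defensive.
Import Order.TTheory GRing.Theory Num.Theory.
Local Open Scope ring_scope.

(* A (multi)graph: finite vertex type V, finite edge type E, and each edge e
   has two (ordered) ends (ends e).1 and (ends e).2 (loops allowed when they
   coincide).  A signature is sigma : E -> bool, with sigma e = true meaning
   that e is NEGATIVE (sigma(e) = -1) and false meaning positive. *)

Definition cut (V E : finType) (ends : E -> V * V) (X : {set V}) : {set E} :=
  [set e | ((ends e).1 \in X) != ((ends e).2 \in X)].

Definition edge_connected (V E : finType) (ends : E -> V * V) (m : nat) : Prop :=
  forall X : {set V}, X != set0 -> X != setT -> (m <= #|cut ends X|)%N.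

(* Switching at v negates the sign of each edge once per end at v
   (so a loop at v keeps its sign, as in sigma'(xy) = zeta(x) sigma(xy) zeta(y)). *)
Definition switch_at (V E : finType) (ends : E -> V * V) (v : V)
  (sigma : E -> bool) : E -> bool :=
  fun e => sigma e (+) ((ends e).1 == v) (+) ((ends e).2 == v).

Definition equivalent (V E : finType) (ends : E -> V * V)
  (sigma sigma' : E -> bool) : Prop :=
  exists s : seq V, sigma' = foldr (switch_at ends) sigma s.

Definition num_neg (E : finType) (sigma : E -> bool) : nat := #|[set e | sigma e]|.

Definition essentially_unbalanced (V E : finType) (ends : E -> V * V)
  (sigma : E -> bool) (m : nat) : Prop :=
  forall sigma', equivalent ends sigma sigma' ->
    ~~ odd (num_neg sigma') \/ (m <= num_neg sigma')%N.

(* An orientation assigns to each end of each edge a direction: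
   (tau e).1 = true means e \in E^+_tau((ends e).1), false means
   e \in E^-_tau((ends e).1); similarly for (tau e).2.
   A positive edge is oriented from one end to the other (the two ends get
   different directions); a negative edge is a sink edge (both true) or a
   source edge (both false). *)
Definition is_orientation (E : finType) (sigma : E -> bool)
  (tau : E -> bool * bool) : Prop :=
  forall e, sigma e = ((tau e).1 == (tau e).2).

Definition boundary (R : realType) (V E : finType) (ends : E -> V * V)
  (tau : E -> bool * bool) (f : E -> R) (v : V) : R :=
  \sum_(e : E)
    ((if (ends e).1 == v then (if (tau e).1 then f e else - f e) else 0)
   + (if (ends e).2 == v then (if (tau e).2 then f e else - f e) else 0)).

Definition is_flow (R : realType) (V E : finType) (ends : E -> V * V)
  (sigma : E -> bool) (tau : E -> bool * bool) (f : E -> R) : Prop :=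
  is_orientation sigma tau /\ forall v, boundary ends tau f v = 0.

Definition circular_flow (R : realType) (V E : finType) (ends : E -> V * V)
  (sigma : E -> bool) (r : R) : Prop :=
  exists (tau : E -> bool * bool) (f : E -> R),
    is_flow ends sigma tau f /\ forall e, 1 <= `|f e| <= r - 1.

(* Phi_c(G,sigma) <= r, where Phi_c is the least r admitting a circular
   r-flow: there is some r' <= r admitting a circular r'-flow. *)
Definition Phi_c_le (R : realType) (V E : finType) (ends : E -> V * V)
  (sigma : E -> bool) (r : R) : Prop :=
  exists r' : R, r' <= r /\ circular_flow ends sigma r'.

(* Main.v *)
Require Import Defs.
From mathcomp Require Import all_boot all_order all_algebra.
From mathcomp Require Import reals zify ring.
Import Order.TTheory GRing.Theory Num.Theory.
Local Open Scope ring_scope.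

(* Switch so that the number of negative edges is least; then at most half of the
   edges of every cut are negative, and the positive edges form a 6k-edge-connected
   graph P.  Since P contains two disjoint connected spanning subgraphs, the
   negative edges can be given values in {k, k+1} up to sign, of total 0, so that
   the resulting demand on every vertex set X is at most k d_P(X) + 2k.  By the
   theorem of Lovasz, Thomassen, Wu and Zhang, P has an orientation whose k-fold
   meets this demand modulo 2k+1, and Hakimi's theorem on orientations with given
   net outdegrees corrects it to an exact flow with values k and k+1.  Dividing by
   k gives a circular (2 + 1/k)-flow.

   The theorem of Lovasz et al. is proved by induction for graphs with a root whose
   edges are already oriented.  A tight set of at least two vertices, other than
   the whole set, is contracted, and so is then its complement; without such sets
   there is enough slack to orient and delete an edge, to lift a pair of edges, or
   to trade an edge for edges at the root. *)

(** With [m = 2k + 1], the modular theorem asks that every cut have at least [2m - 2 + nu] edges,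
    where [nu], the distance from the demand to the multiples of [2m], is at most [m]. This amounts
    to [6k + 1] edges, and parity saves the last one. The demand may exceed [k d_P(X)] by [2k]
    because the correction at the end divides by [m] an expression that is off by at most [4k < 2m],
    and parity absorbs the remainder. An odd number of values [k] and [-k] cannot have sum 0. The
    discrepancy [k] is made up by raising [k] edges of positive value to [k + 1]; that so many exist
    is what having at least [2k + 1] negative edges guarantees. The induction needs a root because
    solving outside a tight set fixes the orientation of the edges that leave it; tightness says
    precisely that these are no more than the root may have. It needs an exempt vertex because a
    tight vertex with demand 0 can afford to lose no edge: it is freed from the cut condition and
    its edges are lifted until it is isolated. *)

Set Implicit Arguments.
Unset Strict Implicit.
Unset Printing Implicit Defensive.

(** * Orientations with given net outdegrees *)

Definition indz (b : bool) : int := (b : nat)%:Z.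

Lemma indzT : indz true = 1. Proof. by []. Qed.

Lemma indzF : indz false = 0. Proof. by []. Qed.

Definition crosses (V : finType) (X : {set V}) (p : V * V) : int :=
  indz ((p.1 \in X) != (p.2 \in X)).

Definition cutz (V E : finType) (g : E -> V * V) (X : {set V}) : int :=
  \sum_e crosses X (g e).

(** Maps [E -> V * V] serve both as graphs and as orientations: read as an orientation, an edge runs
    from its first to its second end. *)
Definition reor (V E : finType) (g h : E -> V * V) :=
  forall e, h e = g e \/ h e = ((g e).2, (g e).1).

Definition net (V E : finType) (h : E -> V * V) (v : V) : int :=
  \sum_e (indz ((h e).1 == v) - indz ((h e).2 == v)).

Definition sumon (V : finType) (t : V -> int) (X : {set V}) : int :=
  \sum_(v in X) t v.

Definition bump (V : finType) (x : V) (c : int) (t : V -> int) : V -> int :=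
  fun v => t v + indz (v == x) * c.

Definition set_end (V E : finType) (g : E -> V * V) (e : E) (p : V * V) : E -> V * V :=
  fun e' => if e' == e then p else g e'.

Lemma sum_in_indz (V : finType) (X : {set V}) (u : V) :
  \sum_(v in X) indz (u == v) = indz (u \in X).
Proof.
case: (boolP (u \in X)) => uX; last first.
  rewrite big1 // => v vX; case: eqP => // uv; by rewrite uv vX in uX.
rewrite (bigD1 u) //= eqxx big1 ?addr0 // => v /andP[_ /negPf].
by rewrite eq_sym => ->.
Qed.

Lemma sumon_bump (V : finType) (x : V) c (t : V -> int) X :
  sumon (bump x c t) X = sumon t X + indz (x \in X) * c.
Proof.
rewrite /sumon /bump big_split /= -mulr_suml.
under [X in _ + X * _]eq_bigr do rewrite eq_sym.
by rewrite sum_in_indz.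
Qed.

Lemma sum_set_end (V E : finType) (g : E -> V * V) (e : E) p (F : V * V -> int) :
  \sum_e' F (set_end g e p e') = \sum_e' F (g e') - F (g e) + F p.
Proof.
rewrite [LHS](bigD1 e) //= [in RHS](bigD1 e) //= /set_end eqxx.
rewrite (eq_bigr (fun e' => F (g e'))); first by lia.
by move=> e' /negPf ->.
Qed.

Lemma cutz_set_end (V E : finType) (g : E -> V * V) e p X :
  cutz (set_end g e p) X = cutz g X - crosses X (g e) + crosses X p.
Proof. exact: sum_set_end. Qed.

Lemma net_set_end (V E : finType) (h : E -> V * V) e p v :
  net (set_end h e p) v = net h v - (indz ((h e).1 == v) - indz ((h e).2 == v))
     + (indz (p.1 == v) - indz (p.2 == v)).
Proof. exact: (@sum_set_end V E h e p (fun p => indz (p.1 == v) - indz (p.2 == v))). Qed.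

Lemma sumon_net (V E : finType) (h : E -> V * V) X :
  sumon (net h) X = \sum_e (indz ((h e).1 \in X) - indz ((h e).2 \in X)).
Proof.
rewrite /sumon /net exchange_big /=; apply: eq_bigr => e _.
by rewrite sumrB !sum_in_indz.
Qed.

Lemma reor_crosses (V : finType) (X : {set V}) (p q : V * V) :
  q = p \/ q = (p.2, p.1) -> crosses X q = crosses X p.
Proof. by case=> -> //; rewrite /crosses eq_sym. Qed.

Lemma reor_cutz (V E : finType) (g h : E -> V * V) X :
  reor g h -> cutz h X = cutz g X.
Proof. by move=> gh; apply: eq_bigr => e _; apply: reor_crosses. Qed.

Lemma crosses_ge0 (V : finType) (X : {set V}) p : 0 <= crosses X p.
Proof. by rewrite /crosses /indz; case: eqP. Qed.

Lemma cutz_ge0 (V E : finType) (g : E -> V * V) X : 0 <= cutz g X.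
Proof. by apply: sumr_ge0 => e _; apply: crosses_ge0. Qed.

Lemma cutz_card (V E : finType) (g : E -> V * V) (X : {set V}) :
  cutz g X = (#|[set e | ((g e).1 \in X) != ((g e).2 \in X)]|)%:Z.
Proof.
rewrite -sum1dep_card big_mkcond (big_morph Posz PoszD (erefl 0%:Z)) /cutz.
by apply: eq_bigr => e _; rewrite /crosses /indz; case: (_ != _).
Qed.

Lemma cutzC (V E : finType) (g : E -> V * V) X : cutz g (~: X) = cutz g X.
Proof. by apply: eq_bigr => e _; rewrite /crosses !inE; do 2 case: (_ \in X). Qed.

Lemma cutzT (V E : finType) (g : E -> V * V) : cutz g [set: V] = 0.
Proof. by apply: big1 => e _; rewrite /crosses !inE. Qed.

Lemma sumonU (V : finType) (t : V -> int) (X Y : {set V}) :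
  sumon t (X :|: Y) + sumon t (X :&: Y) = sumon t X + sumon t Y.
Proof.
rewrite /sumon !(big_mkcond (fun i => i \in _)) /= -!big_split /=.
by apply: eq_bigr => v _; rewrite !inE; do 2 case: (_ \in _); rewrite ?addr0 ?add0r.
Qed.

(** An edge between the two differences is counted twice on the right and not at all by the two cuts
    on the left. This surplus of 2 excludes tight sets that separate the ends of [e] in opposite
    directions. *)
Lemma cutz_submod (V E : finType) (g : E -> V * V) X Y e :
  cutz g (X :|: Y) + cutz g (X :&: Y)
    + 2 * indz (((g e).1 \in X :\: Y) && ((g e).2 \in Y :\: X)) <= cutz g X + cutz g Y.
Proof.
rewrite /cutz -!big_split /= [leRHS](bigD1 e) //=.
rewrite (bigD1 e (P := predT)) //=.
have arr (a b c d f : int) : a + c <= d -> b <= f -> a + b + c <= d + f by lia.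
apply: arr.
  rewrite /crosses /indz !inE.
  by case: ((g e).1 \in X); case: ((g e).2 \in X); case: ((g e).1 \in Y); case: ((g e).2 \in Y).
apply: ler_sum => e' _; rewrite /crosses /indz !inE.
by case: ((g e').1 \in X); case: ((g e').2 \in X); case: ((g e').1 \in Y); case: ((g e').2 \in Y).
Qed.

Definition nonloops (V E : finType) (g : E -> V * V) : {set E} :=
  [set e | (g e).1 != (g e).2].

Lemma nonloops_set_end (V E : finType) (g : E -> V * V) e x :
  (g e).1 != (g e).2 -> (#|nonloops (set_end g e (x, x))| < #|nonloops g|)%N.
Proof.
move=> ge; apply: proper_card; apply/properP; split.
  by apply/subsetP => e'; rewrite !inE /set_end; case: (e' =P e) => //= _; rewrite eqxx.
by exists e; rewrite !inE /set_end ?eqxx //= eqxx.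
Qed.

Lemma sumon_compl (V : finType) (t : V -> int) X : sumon t (~: X) = sumon t [set: V] - sumon t X.
Proof.
have := sumonU t X (~: X); rewrite setUCr setICr.
by rewrite [sumon t set0]big_set0; lia.
Qed.

(* Hakimi's theorem.  If both orientations of an edge uv violate the cut
   condition, there are tight sets separating u from v in both directions, which
   contradicts submodularity. *)
Lemma orientation_with_net (V E : finType) (g : E -> V * V) (t : V -> int) :
  sumon t [set: V] = 0 ->
  (forall X, sumon t X <= cutz g X) ->
  (forall X, exists l : int, cutz g X = sumon t X + 2 * l) ->
  exists h, reor g h /\ forall v, net h v = t v.
Proof.
have [n] := ubnP #|nonloops g|; elim: n => // n IH in g t *.
rewrite ltnS => gn t0 tle tpar.
have [g0|/set0Pn[e]] := eqVneq (nonloops g) set0.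
  have loop e : (g e).1 = (g e).2.
    by apply/eqP; move/setP/(_ e): g0; rewrite !inE => /negbFE.
  have cut0 X : cutz g X = 0 by apply: big1 => e _; rewrite /crosses loop eqxx.
  exists g; split=> [e|v]; first by left.
  have -> : net g v = 0 by apply: big1 => e _; rewrite loop subrr.
  have := tle [set v]; have := tle (~: [set v]).
  by rewrite !cut0 sumon_compl t0 [sumon t [set v]]big_set1; lia.
rewrite inE => ge.
pose g' := set_end g e ((g e).1, (g e).1).
have g'n : (#|nonloops g'| < n)%N.
  exact: leq_trans (nonloops_set_end _ ge) gn.
have cut' X : cutz g' X = cutz g X - crosses X (g e).
  by rewrite cutz_set_end [X in _ + X = _]/crosses eqxx /= addr0.
(* Orienting [e] from [u] to [v] shrinks the cut of a set with [v] and without [u] by one and raises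
   its demand by one. By parity a strict inequality there leaves the 2 that this costs. *)
have key (u v : V) : u != v -> (g e = (u, v) \/ g e = (v, u)) ->
   (forall X : {set V}, u \notin X -> v \in X -> sumon t X < cutz g X) ->
   exists h, reor g h /\ forall v, net h v = t v.
  move=> uv guv tight.
  have cr X : crosses X (g e) = indz ((u \in X) != (v \in X)).
    by case: guv => ->; rewrite /crosses //= eq_sym.
  have [|X|X|h' [gh' net']] := IH g' (bump u (-1) (bump v 1 t)) g'n.
  - by rewrite !sumon_bump !inE t0.
  - rewrite !sumon_bump cut' cr; have := tle X; have := tight X; have [l] := tpar X.
    by case: (u \in X) (v \in X) => [] [] /= l1 l2 l3; rewrite /indz /=; lia.
  - rewrite !sumon_bump cut' cr; have [l] := tpar X.
    case: (u \in X) (v \in X) => [] [] /= l1; rewrite /indz /=;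
    [exists l|exists l|exists (l-1)|exists l]; lia.
  exists (set_end h' e (u, v)); split.
    move=> e'; rewrite /set_end; case: eqP => [->|/eqP ee'].
      by case: guv => ->; [left|right].
    by have := gh' e'; rewrite /g' /set_end (negPf ee').
  move=> w; rewrite net_set_end net' /=.
  have -> : (h' e).1 = (h' e).2.
    by have := gh' e; rewrite /g' /set_end eqxx /=; case=> ->.
  by rewrite /bump (eq_sym w u) (eq_sym w v); lia.
case: (boolP [exists X : {set V}, [&& (g e).1 \notin X, (g e).2 \in X & cutz g X <= sumon t X]]).
  case/existsP=> X /and3P[uX vX tX].
  apply: (key (g e).2 (g e).1); [by rewrite eq_sym|by right; case: (g e)|].
  move=> Y vY uY.
  have := cutz_submod g Y X e; rewrite !inE uX vX uY vY /=.
  have := sumonU t Y X; have := tle (Y :|: X); have := tle (Y :&: X).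
  by rewrite /indz /=; lia.
rewrite negb_exists => /forallP H.
apply: (key (g e).1 (g e).2) => //; first by left; case: (g e).
move=> X uX vX; have := H X; rewrite uX vX /=; lia.
Qed.

(** * Modulo orientations *)

(* The distance from z to the multiples of 2m. *)
Definition nu (m z : int) : int :=
  Num.min (z %% (2 * m))%Z (2 * m - (z %% (2 * m))%Z).

Lemma nu_rep (m z : int) : 0 < m ->
  exists w l : int, [/\ z = w + 2 * m * l, - m < w, w <= m & nu m z = `|w|].
Proof.
move=> m0; rewrite /nu.
have M0 : 2 * m != 0 by lia.
have := divz_eq z (2 * m); have := modz_ge0 z M0.
have := ltz_pmod z (d := 2 * m); rewrite pmulr_rgt0 // => /(_ m0).
set r := (z %% _)%Z; set q := (z %/ _)%Z => r1 r2 zE.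
have [rm|rm] := leP r m.
  by exists r, q; split; lia.
by exists (r - 2 * m), (q + 1); split; lia.
Qed.

Lemma nu_cong (m z w l : int) : z = w + 2 * m * l -> nu m z = nu m w.
Proof.
move=> ->; rewrite /nu.
by rewrite (_ : w + 2 * m * l = l * (2 * m) + w) ?modzMDl //; lia.
Qed.

Lemma nu_small (m w : int) : 0 < m -> - m <= w <= m -> nu m w = `|w|.
Proof.
move=> m0 /andP[w1 w2]; rewrite /nu.
have [w0|w0] := leP 0 w; first by rewrite modz_small; lia.
have -> : (w %% (2 * m))%Z = w + 2 * m.
  rewrite -[w in LHS](addrK (2 * m)) -[- (2 * m)]mulN1r addrC modzMDl modz_small; lia.
lia.
Qed.

Lemma nu_le_norm (m w : int) : 0 < m -> nu m w <= `|w|.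
Proof.
move=> m0; have [w0 [l [-> w1 w2 ->]]] := nu_rep w m0.
have [->|[l1|l1]] : l = 0 \/ (1 <= l \/ l <= -1) by lia.
- by rewrite mulr0 addr0.
- have : m * 1 <= m * l by rewrite ler_pM2l.
  lia.
- have : m * l <= m * -1 by rewrite ler_pM2l.
  lia.
Qed.

Lemma nuD (m x y : int) : 0 < m -> nu m (x + y) <= nu m x + nu m y.
Proof.
move=> m0; have [w [l [-> w1 w2 ->]]] := nu_rep x m0.
have [w' [l' [-> w1' w2' ->]]] := nu_rep y m0.
rewrite (@nu_cong _ _ (w + w') (l + l')); last by lia.
have := nu_le_norm (w + w') m0; lia.
Qed.

Lemma nuN (m x : int) : 0 < m -> nu m (- x) = nu m x.
Proof.
move=> m0; have [w [l [-> w1 w2 ->]]] := nu_rep x m0.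
rewrite (@nu_cong _ _ (- w) (- l)); last by lia.
rewrite nu_small //; lia.
Qed.

Lemma nu_ge0 (m x : int) : 0 < m -> 0 <= nu m x.
Proof. by move=> m0; have [w [l [_ _ _ ->]]] := nu_rep x m0. Qed.

Lemma nu_le (m x : int) : 0 < m -> nu m x <= m.
Proof. move=> m0; have [w [l [_ w1 w2 ->]]] := nu_rep x m0; lia. Qed.

(** The modulus [2 * m] is even, so residues keep their parity. Net outdegree is twice the outdegree
    minus the degree; prescribing it modulo [2 * m] with the right parity is prescribing the
    outdegree modulo [m]. *)
Lemma nu_par (m x : int) : 0 < m -> exists l : int, nu m x = x + 2 * l.
Proof.
move=> m0; have [w [l [-> w1 w2 ->]]] := nu_rep x m0.
have [w0|w0] := leP 0 w; first by exists (- (m * l)); lia.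
by exists (- w - m * l); lia.
Qed.

Lemma nuD_norm (m x c : int) : 0 < m -> nu m (x + c) <= nu m x + `|c|.
Proof. by move=> m0; have := nuD x c m0; have := nu_le_norm c m0; lia. Qed.

(** The degree of [X] in the graph with its root, which lies outside every [X]. When all other edges
    stay inside [W], the value at [W] is the degree of the root. *)
Definition degz (V E : finType) (g : E -> V * V) (i o : V -> int) X : int :=
  cutz g X + sumon i X + sumon o X.

(* A graph on W together with an implicit root whose edges are already oriented:
   i v of them enter v and o v leave v.  The net outdegree of v, root edges
   included, has to be t v modulo 2m.  Edges are deleted by turning them into
   loops.  At most one vertex, the element of S, is exempt from the cut
   condition. *)
Record admissible (V E : finType) (m : int) (W S : {set V}) (g : E -> V * V)
    (t i o : V -> int) : Prop := Admissible {
  adm_wf : forall e, (g e).1 != (g e).2 -> (g e).1 \in W /\ (g e).2 \in W;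
  adm_ge0 : forall v, 0 <= i v /\ 0 <= o v;
  adm_exempt : forall x, x \in S -> exists l : int, t x = 2 * m * l;
  adm_exempt1 : forall x y, x \in S -> y \in S -> x = y;
  adm_par : forall X : {set V}, X \subset W -> exists l : int, degz g i o X = sumon t X + 2 * l;
  adm_sum : exists l : int, sumon t W = sumon o W - sumon i W + 2 * m * l;
  adm_cut : forall X : {set V}, X \subset W -> X != set0 -> X != W ->
    (forall x, x \in S -> X != [set x]) ->
    2 * m - 2 + nu m (sumon t X) <= degz g i o X;
  adm_root : degz g i o W <= 2 * m - 2 + nu m (sumon t W) }.

Definition extendable (V E : finType) (m : int) (W : {set V}) (g : E -> V * V)
    (t i o : V -> int) : Prop :=
  exists h, reor g h /\
    forall v, v \in W -> exists l : int, net h v + o v - i v = t v + 2 * m * l.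

Lemma reor_rev (V E : finType) (g h : E -> V * V) :
  reor g h -> reor g (fun e => ((h e).2, (h e).1)).
Proof. by move=> gh e; have [->|->] := gh e; [right|left; case: (g e)]. Qed.

Lemma net_rev (V E : finType) (h : E -> V * V) v :
  net (fun e => ((h e).2, (h e).1)) v = - net h v.
Proof. by rewrite /net -sumrN; apply: eq_bigr => e _; rewrite opprB. Qed.

Lemma sumonN (V : finType) (t : V -> int) X : sumon (fun v => - t v) X = - sumon t X.
Proof. by rewrite /sumon sumrN. Qed.

(** Reversing all edges, root edges included, is a symmetry that halves the case analyses below. *)
Lemma admissible_rev (V E : finType) (m : int) (W S : {set V}) (g : E -> V * V) t i o :
  0 < m -> admissible m W S g t i o -> admissible m W S g (fun v => - t v) o i.
Proof.
move=> m0 [wf ge0 ex ex1 par [l sumE] cut root]; split => //.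
- by move=> v; case: (ge0 v).
- by move=> x /ex[l' ->]; exists (- l'); lia.
- by move=> X /par[l' lE]; exists (l' + sumon t X); rewrite sumonN; move: lE; rewrite /degz; lia.
- by exists (- l); rewrite sumonN; lia.
- by move=> X X1 X2 X3 X4; have := cut X X1 X2 X3 X4; rewrite sumonN nuN // /degz; lia.
- by move: root; rewrite sumonN nuN // /degz; lia.
Qed.

Lemma extendable_rev (V E : finType) (m : int) (W : {set V}) (g : E -> V * V) t i o :
  extendable m W g (fun v => - t v) o i -> extendable m W g t i o.
Proof.
move=> [h [gh hn]]; exists (fun e => ((h e).2, (h e).1)); split; first exact: reor_rev.
by move=> v /hn[l lE]; exists (- l); rewrite net_rev; lia.
Qed.

Lemma cutz_wf (V E : finType) (g : E -> V * V) (W X : {set V}) :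
  (forall e, (g e).1 != (g e).2 -> (g e).1 \in W /\ (g e).2 \in W) ->
  cutz g X = cutz g (X :&: W).
Proof.
move=> wf; apply: eq_bigr => e _; rewrite /crosses !inE.
have [->|/wf[-> ->]] := eqVneq (g e).1 (g e).2; first by rewrite !eqxx.
by rewrite !andbT.
Qed.

Lemma cutz_compl (V E : finType) (g : E -> V * V) (W X : {set V}) :
  (forall e, (g e).1 != (g e).2 -> (g e).1 \in W /\ (g e).2 \in W) ->
  cutz g (W :\: X) = cutz g X.
Proof.
move=> wf; rewrite -[RHS]cutzC [RHS](cutz_wf _ wf); congr cutz.
by apply/setP => v; rewrite !inE andbC.
Qed.

Lemma sumon_diff (V : finType) (t : V -> int) (W X : {set V}) : X \subset W ->
  sumon t (W :\: X) = sumon t W - sumon t X.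
Proof.
move=> XW; have := sumonU t X (W :\: X).
have -> : X :|: (W :\: X) = W.
  apply/setP => v; rewrite !inE; have := subsetP XW v.
  by case: (v \in X) => //= ->.
have -> : X :&: (W :\: X) = set0 by apply/setP => v; rewrite !inE; case: (v \in X).
rewrite [sumon t set0]big_set0; lia.
Qed.

Lemma sumon1 (V : finType) (t : V -> int) x : sumon t [set x] = t x.
Proof. by rewrite /sumon big_set1. Qed.

Lemma cutz0 (V E : finType) (g : E -> V * V) : cutz g set0 = 0.
Proof. by apply: big1 => e _; rewrite /crosses !inE. Qed.

Lemma sumon0 (V : finType) (t : V -> int) : sumon t set0 = 0.
Proof. by rewrite /sumon big_set0. Qed.

Lemma sumon2 (V : finType) (t : V -> int) x y : x != y -> sumon t [set x; y] = t x + t y.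
Proof. by move=> xy; rewrite /sumon big_setU1 ?inE //= big_set1. Qed.

(** Besides loops there are only parallel edges, so it suffices to find a value [b] for their net
    flow from [x] to [y] that has the right residue and parity and is at most their number;
    [adm_sum] then settles [y]. *)
Lemma extend_two (V E : finType) (m : int) (S : {set V}) (g : E -> V * V) t i o (x y : V) :
  2 <= m -> x != y -> y \notin S -> admissible m [set x; y] S g t i o ->
  extendable m [set x; y] g t i o.
Proof.
move=> m2 xy yS [wf ge0 ex ex1 par [ls sumE] cut root].
have m0 : 0 < m by lia.
set W := [set x; y] in wf par sumE cut root *.
have xW : [set x] \subset W by rewrite sub1set !inE eqxx.
have yW : [set y] \subset W by rewrite sub1set !inE eqxx orbT.
have Wx : W :\: [set x] = [set y].
  apply/setP => v; rewrite !inE; have [->|vx] //= := eqVneq v x.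
  by rewrite (negPf xy).
have nx : [set x] != W by apply/eqP => /setP/(_ y); rewrite !inE eqxx orbT eq_sym (negPf xy).
have ny : [set y] != W by apply/eqP => /setP/(_ x); rewrite !inE eqxx /= (negPf xy).
have n0 z : [set z] != set0 :> {set V} by apply/set0Pn; exists z; rewrite inE.
have sumW (f : V -> int) : sumon f W = f x + f y by rewrite sumon2.
have cutW : cutz g W = 0 by have := cutz_compl W wf; rewrite setDv cutz0.
have pE : cutz g [set y] = cutz g [set x] by rewrite -Wx (cutz_compl _ wf).
have cuty : 2 * m - 2 + nu m (t y) <= cutz g [set x] + i y + o y.
  have := cut _ yW (n0 y) ny; rewrite /degz !sumon1 pE; apply.
  by move=> z zS; apply/eqP => /set1_inj yz; rewrite yz zS in yS.
have rootE : i x + i y + o x + o y <= 2 * m - 2 + nu m (t x + t y).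
  by move: root; rewrite /degz cutW !sumW; lia.
have [p1 pxE] := par _ xW; rewrite /degz !sumon1 in pxE.
have := sumE; rewrite !sumW => sE.
have := ge0 x; have := ge0 y => - [iy oy] [ix ox].
have [b [lb [bE ble bpar]]] : exists b l : int, [/\ b = t x - o x + i x + 2 * m * l,
    `|b| <= cutz g [set x] & exists l', cutz g [set x] = b + 2 * l'].
  (* For an exempt [x], the cut condition at [y] and the root bound show that [x] has at most as
     many root edges as there are parallel edges. *)
  case: (boolP (x \in S)) => [xS|xS].
    have [l tx] := ex _ xS.
    exists (i x - o x), (- l); split; first lia.
      have : nu m (t x + t y) = nu m (t y) by apply: (@nu_cong _ _ _ l); lia.
      lia.
    exists (p1 + m * l - i x); lia.
  have cutx : 2 * m - 2 + nu m (t x) <= cutz g [set x] + i x + o x.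
    have := cut _ xW (n0 x) nx; rewrite /degz !sumon1; apply.
    by move=> z zS; apply/eqP => /set1_inj xz; rewrite xz zS in xS.
  (* The two cut conditions and the root bound give at least [m - 1] parallel edges. As [w] has
     absolute value at most [m], it could exceed their number only by one, which parity excludes. *)
  have := nuD (t x) (t y) m0.
  have [w [l [wE w1 w2 _]]] := nu_rep (t x - o x + i x) m0 => nuxy.
  exists w, (- l); split; [lia| |exists (p1 + m * l - i x); lia].
  have : exists l', cutz g [set x] = w + 2 * l' by exists (p1 + m * l - i x); lia.
  case=> l' ?; lia.
pose tt := bump x b (bump y (- b) (fun=> 0)).
have ttE X : sumon tt X = indz (x \in X) * b - indz (y \in X) * b.
  by rewrite !sumon_bump [sumon (fun=> 0) X]big1 //; lia.
have cutX X : cutz g X = if (x \in X) == (y \in X) then 0 else cutz g [set x].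
  rewrite (cutz_wf X wf).
  have [xX|xX] := boolP (x \in X); have [yX|yX] := boolP (y \in X) => /=.
  - by rewrite (_ : X :&: W = W) //; apply/setIidPr/subsetP => v;
       rewrite !inE => /orP[] /eqP ->.
  - rewrite (_ : X :&: W = [set x]) //; apply/setP => v; rewrite !inE.
    have [->|vx] := eqVneq v x; first by rewrite xX.
    by have [->|] := eqVneq v y; rewrite ?(negPf yX) ?andbF.
  - rewrite (_ : X :&: W = [set y]) //; apply/setP => v; rewrite !inE.
    have [->|vx] := eqVneq v y; first by rewrite yX orbT.
    by have [->|] := eqVneq v x; rewrite ?(negPf xX) ?andbF.
  - rewrite (_ : X :&: W = set0) ?cutz0 //; apply/setP => v; rewrite !inE.
    have [->|vx] := eqVneq v y; first by rewrite (negPf yX).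
    by have [->|] := eqVneq v x; rewrite ?(negPf xX) ?andbF.
have [lp lpE] := bpar.
have [|X|X|h [gh hn]] := @orientation_with_net V E g tt.
- by rewrite ttE !inE; lia.
- rewrite ttE cutX; case: (x \in X); case: (y \in X) => /=; rewrite /indz /=; lia.
- rewrite ttE cutX; case: (x \in X); case: (y \in X) => /=; rewrite /indz /=.
  + by exists 0; lia.
  + by exists lp; lia.
  + by exists (lp + b); lia.
  + by exists 0; lia.
exists h; split=> // v; rewrite hn /tt /bump !inE => /orP[] /eqP ->.
  by exists lb; rewrite eqxx (negPf xy) /indz /=; lia.
by exists (- ls - lb); rewrite eqxx eq_sym (negPf xy) /indz /=; lia.
Qed.

Lemma sumon_count (V E : finType) (f : E -> V) (c : E -> bool) X :
  sumon (fun v => \sum_e indz ((f e == v) && c e)) X = \sum_e indz ((f e \in X) && c e).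
Proof.
rewrite /sumon exchange_big /=; apply: eq_bigr => e _.
case: (c e); last by rewrite andbF big1 // => v _; rewrite andbF.
by rewrite andbT -sum_in_indz; apply: eq_bigr => v _; rewrite andbT.
Qed.

Lemma sumonD (V : finType) (f f' : V -> int) X :
  sumon (fun v => f v + f' v) X = sumon f X + sumon f' X.
Proof. by rewrite /sumon big_split. Qed.

(** * Contraction of a tight set *)

Section Contract.
Variables (V : finType) (A : {set V}) (a : V).
Hypothesis aA : a \in A.

(** The set [A] is contracted to its own member [a], so that the vertex type stays the same; [W1]
    will be the vertex set after contraction. *)
Definition squash (v : V) := if v \in A then a else v.
Definition unsquash (X : {set V}) := if a \in X then X :|: A else X.
Definition squash_wt (f : V -> int) v := if v == a then sumon f A else f v.

Variable W1 : {set V}.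
Hypothesis W1A : forall v, v \in W1 -> v \in A -> v = a.

Lemma mem_squash (X : {set V}) u : X \subset W1 -> (squash u \in X) = (u \in unsquash X).
Proof.
move=> /subsetP XW; rewrite /squash /unsquash.
case: (boolP (a \in X)) => aX; case: ifP => uA; rewrite ?inE ?uA ?aX ?orbT ?orbF //.
by rewrite (negPf aX); apply/esym/negbTE/negP => uX; rewrite -(W1A (XW _ uX) uA) uX in aX.
Qed.

Lemma sumon_squash_wt f (X : {set V}) : X \subset W1 ->
  sumon (squash_wt f) X = sumon f (unsquash X).
Proof.
move=> /subsetP XW; rewrite /unsquash; case: (boolP (a \in X)) => aX; last first.
  by apply: eq_bigr => v vX; rewrite /squash_wt; case: eqP => // va; rewrite -va vX in aX.
have := sumonU f (X :\ a) A.
have -> : (X :\ a) :|: A = X :|: A.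
  by apply/setP => v; rewrite !inE; have [->|//] := eqVneq v a; rewrite aA !orbT.
have -> : (X :\ a) :&: A = set0.
  apply/setP => v; rewrite !inE; apply/negbTE/negP => /andP[/andP[va vX] vA].
  by rewrite (W1A (XW _ vX) vA) eqxx in va.
rewrite sumon0 addr0 => ->.
rewrite /sumon (big_setD1 a) //= {1}/squash_wt eqxx addrC; congr (_ + _).
by apply: eq_bigr => v; rewrite !inE /squash_wt => /andP[/negPf ->].
Qed.

End Contract.

(* Solve with A contracted, then inside A with the rest of the graph contracted
   into the root. *)
Lemma extend_contract (V E : finType) (m : int) (W S A : {set V}) (g : E -> V * V) t i o :
  0 < m -> admissible m W S g t i o ->
  A \subset W -> (1 < #|A|)%N -> A != W ->
  degz g i o A = 2 * m - 2 + nu m (sumon t A) ->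
  (forall (W' S' : {set V}) g' t' i' o', (1 < #|W'| < #|W|)%N ->
     @admissible V E m W' S' g' t' i' o' -> extendable m W' g' t' i' o') ->
  extendable m W g t i o.
Proof.
move=> m0 [wf ge0 ex ex1 par [ls sumE] cut root] AW A2 nAW tight IH.
have /card_gt0P[a aA] : (0 < #|A|)%N by apply: leq_trans A2.
have Aproper : (#|A| < #|W|)%N by apply: proper_card; rewrite properEneq nAW.
pose W1 := a |: (W :\: A).
have W1A v : v \in W1 -> v \in A -> v = a.
  by rewrite !inE => /orP[/eqP //|/andP[/negPf ->]].
have aW1 : a \in W1 by rewrite !inE eqxx.
have aW : a \in W by apply: (subsetP AW).
have up_sub (X : {set V}) : X \subset W1 -> unsquash A a X \subset W.
  move=> XW; have XW' : X \subset W.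
    apply: subset_trans XW _; apply/subsetP => v; rewrite !inE.
    by case/orP => [/eqP ->//|/andP[]].
  by rewrite /unsquash; case: ifP => // _; rewrite subUset XW' AW.
have upW1 : unsquash A a W1 = W.
  rewrite /unsquash aW1; apply/setP => v; rewrite !inE.
  have [vA|vA] /= := boolP (v \in A); first by rewrite orbT (subsetP AW).
  by rewrite orbF; case: eqP => // va; rewrite va aA in vA.
pose g1 e := (squash A a (g e).1, squash A a (g e).2).
pose t1 := squash_wt A a t; pose i1 := squash_wt A a i; pose o1 := squash_wt A a o.
have dzE (X : {set V}) : X \subset W1 -> degz g1 i1 o1 X = degz g i o (unsquash A a X).
  move=> XW; rewrite /degz !(sumon_squash_wt aA W1A _ XW); congr (_ + _ + _).
  by apply: eq_bigr => e _; rewrite /crosses /= !(mem_squash W1A _ XW).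
have smE f (X : {set V}) : X \subset W1 -> sumon (squash_wt A a f) X = sumon f (unsquash A a X).
  exact: (sumon_squash_wt aA W1A).
have cardW1 : #|W1| = (#|W :\: A|).+1 by rewrite cardsU1 !inE aA.
have cardWA : #|W :\: A| = (#|W| - #|A|)%N by rewrite cardsD (setIidPr AW).
have [||h1 [gh1 hn1]] := IH W1 (S :\: A) g1 t1 i1 o1; first by lia.
  split.
  - have sqW u : u \in W -> squash A a u \in W1.
      by move=> uW; rewrite /squash; case: ifP => // uA; rewrite !inE uA uW orbT.
    move=> e /= ne; have /wf[u1 u2] : (g e).1 != (g e).2.
      by apply: contraNneq ne => ->.
    by split; apply: sqW.
  - move=> v; rewrite /i1 /o1 /squash_wt; case: eqP => _ //.
    by split; apply: sumr_ge0 => u _; case: (ge0 u).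
  - move=> x; rewrite inE => /andP[xA /ex[l lE]]; exists l.
    by rewrite /t1 /squash_wt; case: eqP => // xa; rewrite xa aA in xA.
  - by move=> x y; rewrite !inE => /andP[_ xS] /andP[_ yS]; apply: ex1.
  - by move=> X XW; rewrite dzE // smE //; apply: par; apply: up_sub.
  - by exists ls; rewrite !smE // upW1.
  - move=> X XW X0 XW1 Xex; rewrite dzE // smE //; apply: cut.
    + exact: up_sub.
    + have /set0Pn[v vX] := X0; apply/set0Pn; exists v.
      by rewrite /unsquash; case: ifP => // _; rewrite inE vX.
    + apply: contraNneq XW1 => upX; rewrite eqEsubset XW /=; apply/subsetP => v.
      have aX : a \in X by apply: contraT => aX; move: aW; rewrite -upX /unsquash (negPf aX) (negPf aX).
      move: upX; rewrite /unsquash aX !inE => upX /orP[/eqP -> //|/andP[vA]].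
      by rewrite -upX inE (negPf vA) orbF.
    + move=> x xS; apply/eqP; rewrite /unsquash; case: ifP => aX upX.
        have : A \subset [set x] by rewrite -upX subsetUr.
        by move/subset_leq_card; rewrite cards1 leqNgt A2.
      have /eqP := upX; apply/negP; apply: Xex.
      rewrite inE xS andbT; apply/negP => xA.
      have xX : x \in X by rewrite upX inE.
      by move: aX; rewrite -(W1A _ (subsetP XW _ xX) xA) xX.
  - by rewrite dzE // smE // upW1.
(* Edges inside [A] are loops of [g1], where [h1] and [g1] agree; [hh] therefore leaves them as in
   [g], to be oriented in the second stage. *)
pose hh e := if h1 e == g1 e then g e else ((g e).2, (g e).1).
have hhg : reor g hh by move=> e; rewrite /hh; case: ifP => _; [left|right].
have hh1 e : h1 e = (squash A a (hh e).1, squash A a (hh e).2).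
  by rewrite /hh; case: eqP => [->|] //; case: (gh1 e) => ->.
pose inA e := ((hh e).1 \in A) && ((hh e).2 \in A).
pose g2 e := if inA e then hh e else (a, a).
pose o2 v := o v + \sum_e indz (((hh e).1 == v) && ((hh e).2 \notin A)).
pose i2 v := i v + \sum_e indz (((hh e).2 == v) && ((hh e).1 \notin A)).
have smo2 X : sumon o2 X = sumon o X + \sum_e indz (((hh e).1 \in X) && ((hh e).2 \notin A)).
  by rewrite /o2 sumonD sumon_count.
have smi2 X : sumon i2 X = sumon i X + \sum_e indz (((hh e).2 \in X) && ((hh e).1 \notin A)).
  by rewrite /i2 sumonD sumon_count.
have dz2 (X : {set V}) : X \subset A -> degz g2 i2 o2 X = degz g i o X.
  move=> /subsetP XA; rewrite /degz smo2 smi2.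
  suff <- : cutz g2 X + \sum_e indz (((hh e).1 \in X) && ((hh e).2 \notin A))
      + \sum_e indz (((hh e).2 \in X) && ((hh e).1 \notin A)) = cutz g X by lia.
  rewrite -(reor_cutz _ hhg) /cutz -!big_split /=; apply: eq_bigr => e _.
  rewrite /g2 /crosses; have := XA (hh e).1; have := XA (hh e).2.
  have : inA e = ((hh e).1 \in A) && ((hh e).2 \in A) by [].
  case: (inA e) => /=; rewrite ?eqxx /=; case: ((hh e).1 \in X); case: ((hh e).2 \in X);
    case: ((hh e).1 \in A); case: ((hh e).2 \in A) => H0 H1 H2 //; by [have := H1 isT|have := H2 isT].
have indz_sum (c : E -> bool) : 0 <= \sum_e indz (c e) by apply: sumr_ge0 => e _.
have [||h2 [gh2 hn2]] := IH A (S :&: A) g2 t i2 o2; first by rewrite A2.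
  split.
  - by move=> e; rewrite /g2; case: ifP => [/andP[-> ->]|] //=; rewrite eqxx.
  - by move=> v; have [iv ov] := ge0 v; split; rewrite addr_ge0.
  - by move=> x; rewrite inE => /andP[/ex].
  - by move=> x y; rewrite !inE => /andP[xS _] /andP[yS _]; apply: ex1.
  - by move=> X XA; rewrite dz2 //; apply: par; apply: subset_trans AW.
  (* The first stage met the demand of [a], which is the total demand of [A]; this is the sum
     condition for the second stage. *)
  - have [l] := hn1 a aW1; rewrite /t1 /o1 /i1 /squash_wt eqxx => lE.
    exists (- l); rewrite smo2 smi2.
    suff : net h1 a = \sum_e indz (((hh e).1 \in A) && ((hh e).2 \notin A))
       - \sum_e indz (((hh e).2 \in A) && ((hh e).1 \notin A)) by lia.
    rewrite -sumrB; apply: eq_bigr => e _; rewrite hh1 /=.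
    have sqa u : (squash A a u == a) = (u \in A).
      by rewrite /squash; case: ifP => uA; rewrite ?eqxx //; apply/eqP => ua; rewrite ua aA in uA.
    by rewrite !sqa; case: ((hh e).1 \in A); case: ((hh e).2 \in A).
  - move=> X XA X0 XnA Xex; rewrite dz2 //; apply: cut => //.
    + exact: subset_trans AW.
    + apply: contraNneq XnA => XW; rewrite XW in XA *.
      by rewrite eqEsubset XA AW.
    + move=> x xS; apply/eqP => Xx; have : x \in S :&: A.
        by rewrite inE xS; apply: (subsetP XA); rewrite Xx inE.
      by move/Xex; rewrite Xx eqxx.
  (* Here tightness enters: the edges leaving [A] are as many as the root may have. *)
  - by rewrite dz2 // tight.
pose h e := if inA e then h2 e else hh e.
exists h; split.
  move=> e; rewrite /h; case: ifP => // Ae.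
  have := gh2 e; rewrite /g2 Ae => -[->|->] //.
  by case: (hhg e) => ->; [right|left; case: (g e)].
have h2A e : inA e -> ((h2 e).1 \in A) && ((h2 e).2 \in A).
  move=> Ae; have := gh2 e; rewrite /g2 Ae; move: Ae; rewrite /inA.
  by move=> /andP[A1 A2'] [] -> /=; rewrite A1 A2'.
move=> v vW; have [vA|vA] := boolP (v \in A).
  have [l lE] := hn2 v vA; exists l; rewrite -lE /o2 /i2.
  suff : net h v = net h2 v + \sum_e indz (((hh e).1 == v) && ((hh e).2 \notin A))
     - \sum_e indz (((hh e).2 == v) && ((hh e).1 \notin A)) by lia.
  rewrite /net -big_split -sumrB /=; apply: eq_bigr => e _; rewrite /h.
  have [Ae|Ae] := boolP (inA e).
    by have /andP[-> ->] := Ae; rewrite !andbF addr0 subr0.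
  have -> : indz ((h2 e).1 == v) - indz ((h2 e).2 == v) = 0.
    by have := gh2 e; rewrite /g2 (negPf Ae) => -[] -> /=; rewrite subrr.
  move: Ae; rewrite /inA negb_and add0r.
  have [v1|v1] := eqVneq (hh e).1 v; have [v2|v2] := eqVneq (hh e).2 v; rewrite ?v1 ?v2 ?vA //=.
    by move=> ->.
  by rewrite orbF => ->.
have [|l] := hn1 v; first by rewrite !inE vA vW orbT.
have va : v == a = false by apply/eqP => va; rewrite va aA in vA.
rewrite /t1 /i1 /o1 /squash_wt va => lE; exists l; rewrite -lE.
suff -> : net h v = net h1 v by [].
apply: eq_bigr => e _; rewrite hh1 /h /=.
have sqv u : (squash A a u == v) = (u == v).
  rewrite /squash; case: ifP => // uA; rewrite eq_sym va; apply/esym/eqP => uv.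
  by rewrite -uv uA in vA.
rewrite !sqv; case: ifP => // Ae; have nv u : u \in A -> (u == v) = false.
  by move=> uA; apply/eqP => uv; rewrite -uv uA in vA.
by have /andP[b1 b2] := h2A _ Ae; have /andP[b3 b4] := Ae; rewrite !nv.
Qed.

(** * Edges at a vertex, and lifting at the exempt vertex *)

Lemma crosses_loop (V : finType) (X : {set V}) x : crosses X (x, x) = 0.
Proof. by rewrite /crosses eqxx. Qed.

Definition joins (V E : finType) (g : E -> V * V) (e : E) (x y : V) :=
  x != y /\ (g e = (x, y) \/ g e = (y, x)).

Lemma joins_crosses (V E : finType) (g : E -> V * V) e x y X :
  joins g e x y -> crosses X (g e) = indz ((x \in X) != (y \in X)).
Proof. by move=> [_ [] ->]; rewrite /crosses //= eq_sym. Qed.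

Lemma joins_neq (V E : finType) (g : E -> V * V) e x y :
  joins g e x y -> (g e).1 != (g e).2.
Proof. by move=> [xy [] ->] //=; rewrite eq_sym. Qed.

Lemma joinsC (V E : finType) (g : E -> V * V) e x y :
  joins g e x y -> joins g e y x.
Proof. by move=> [xy g1]; split; [rewrite eq_sym|tauto]. Qed.

Lemma cut_joins (V E : finType) (g : E -> V * V) (X : {set V}) :
  0 < cutz g X -> exists e u v, [/\ joins g e u v, u \in X & v \notin X].
Proof.
move=> p0; case: (boolP [exists e, ((g e).1 \in X) != ((g e).2 \in X)]).
  case/existsP=> e ne.
  have e12 : (g e).1 != (g e).2 by apply: contraNneq ne => ->.
  case e1 : ((g e).1 \in X) ne; case e2 : ((g e).2 \in X) => // _.
    exists e, (g e).1, (g e).2; split; rewrite ?e1 ?e2 //.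
    by split => //; left; case: (g e).
  exists e, (g e).2, (g e).1; split; rewrite ?e1 ?e2 //.
  by split; [rewrite eq_sym|right; case: (g e)].
rewrite negb_exists => /forallP H; move: p0; rewrite /cutz big1 ?ltxx // => e _.
by rewrite /crosses; have := H e; rewrite negbK => /eqP ->; rewrite eqxx.
Qed.

Lemma cut1_joins (V E : finType) (g : E -> V * V) x :
  0 < cutz g [set x] -> exists e y, joins g e x y.
Proof. by move=> /cut_joins[e [u [v [J /set1P <- _]]]]; exists e, v. Qed.

Lemma joins_wf (V E : finType) (g : E -> V * V) (W : {set V}) e x y :
  (forall e, (g e).1 != (g e).2 -> (g e).1 \in W /\ (g e).2 \in W) ->
  joins g e x y -> x \in W /\ y \in W.
Proof.
by move=> wf J; have [] := wf e (joins_neq J); case: J => _ [] ->.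
Qed.

Lemma card_gt1_mem (T : finType) (X : {set T}) x :
  x \in X -> X != [set x] -> (1 < #|X|)%N.
Proof.
move=> xX nX; rewrite ltnNge; apply: contra nX => X1; rewrite eq_sym eqEcard sub1set xX.
by rewrite cards1.
Qed.

(** The two sides of [adm_cut] have the same parity, so a set that is not tight has 2 to spare:
    enough to lose two edges, or one edge while the demand changes by one. *)
Definition slack (V E : finType) (m : int) (W : {set V}) (g : E -> V * V) t i o :=
  forall X : {set V}, X \subset W -> (1 < #|X|)%N -> X != W ->
    2 * m + nu m (sumon t X) <= degz g i o X.

Lemma slack_or_extendable (V E : finType) (m : int) (W S : {set V}) (g : E -> V * V) t i o :
  0 < m -> admissible m W S g t i o ->
  (forall (W' S' : {set V}) g' t' i' o', (1 < #|W'| < #|W|)%N ->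
     @admissible V E m W' S' g' t' i' o' -> extendable m W' g' t' i' o') ->
  slack m W g t i o \/ extendable m W g t i o.
Proof.
move=> m0 adm IH.
case: (boolP [exists A : {set V}, [&& A \subset W, (1 < #|A|)%N, A != W
    & degz g i o A == 2 * m - 2 + nu m (sumon t A)]]).
  case/existsP=> A /and4P[AW A2 nAW /eqP tight]; right.
  exact: (extend_contract m0 adm AW A2 nAW tight).
rewrite negb_exists => /forallP H; left => X XW X2 nXW.
have [l] := adm_par adm XW; have [l'] := nu_par (sumon t X) m0.
have X0 : X != set0 by rewrite -card_gt0 (ltn_trans _ X2).
have Xs x : x \in S -> X != [set x].
  by move=> _; apply: contraTneq X2 => ->; rewrite cards1.
by have := adm_cut adm XW X0 nXW Xs; have := H X; rewrite XW X2 nXW /=; lia.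
Qed.

Lemma slack_rev (V E : finType) (m : int) (W : {set V}) (g : E -> V * V) t i o :
  0 < m -> slack m W g t i o -> slack m W g (fun v => - t v) o i.
Proof.
move=> m0 sl X XW X2 nXW; have := sl X XW X2 nXW.
by rewrite sumonN nuN // /degz; lia.
Qed.

Lemma wf_set_end (V E : finType) (g : E -> V * V) (W : {set V}) e u v :
  (forall e, (g e).1 != (g e).2 -> (g e).1 \in W /\ (g e).2 \in W) ->
  u = v \/ u \in W /\ v \in W ->
  forall e', (set_end g e (u, v) e').1 != (set_end g e (u, v) e').2 ->
    (set_end g e (u, v) e').1 \in W /\ (set_end g e (u, v) e').2 \in W.
Proof.
move=> wf uv e'; rewrite /set_end; case: (e' =P e) => _; last exact: wf.
by case: uv => [->|]; rewrite ?eqxx.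
Qed.

Lemma reor_loop (V E : finType) (g h : E -> V * V) e :
  reor g h -> (g e).1 = (g e).2 -> (h e).1 = (h e).2.
Proof. by move=> gh ge; case: (gh e) => ->. Qed.

Lemma reor_set_end (V E : finType) (g h : E -> V * V) e p q :
  reor (set_end g e p) h -> q = g e \/ q = ((g e).2, (g e).1) ->
  reor g (set_end h e q).
Proof.
by move=> gh qE e'; have := gh e'; rewrite /set_end; case: (e' =P e) => [->|].
Qed.

(* Lift the path root - x - u. *)
Lemma lift_root (V E : finType) (m : int) (W : {set V}) (g : E -> V * V) t i o x e u :
  0 < m -> x \in W -> admissible m W [set x] g t i o -> slack m W g t i o ->
  joins g e x u -> 0 < i x ->
  exists (g' : E -> V * V) i', [/\ admissible m W [set x] g' t i' o,
     degz g' i' o [set x] = degz g i o [set x] - 2 &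
     extendable m W g' t i' o -> extendable m W g t i o].
Proof.
move=> m0 xW [wf ge0 ex ex1 par [ls sumE] cut root] sl J ix.
have [_ uW] := joins_wf wf J; have [xu ge] := J.
pose g' := set_end g e (x, x); pose i' := bump u 1 (bump x (-1) i).
have dzE X : degz g' i' o X = degz g i o X - indz ((x \in X) != (u \in X))
   - indz (x \in X) + indz (u \in X).
  rewrite /degz /i' !sumon_bump cutz_set_end (joins_crosses _ J).
  by rewrite crosses_loop; lia.
exists g', i'; split.
- split => //.
  + by apply: wf_set_end => //; left.
  + move=> v; have [iv ov] := ge0 v; split => //; rewrite /i' /bump /indz.
    by have [->|] := eqVneq v x; case: (_ == u) => /=; lia.
  + move=> X XW; have [l lE] := par X XW; rewrite dzE lE; clear.
    case: (x \in X); case: (u \in X); rewrite /indz /=;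
      [exists l|exists (l-1)|exists l|exists l]; lia.
  + by exists ls; rewrite /i' !sumon_bump xW uW /indz /= sumE; lia.
  (* Only sets that contain [x] and not [u] lose degree, namely 2. As [[set x]] is exempt, they have
     a second vertex and [slack] applies. *)
  + move=> X XW X0 XnW Xex; rewrite dzE; have := cut X XW X0 XnW Xex.
    have := sl X XW; have := @card_gt1_mem _ X x.
    have := Xex x; rewrite inE eqxx => /(_ isT) Xx.
    case: (x \in X) => [/(_ isT Xx) -> /(_ isT XnW)|_ _];
      clear; case: (u \in X); rewrite /indz /=; lia.
  + by rewrite dzE xW uW /indz /=; move: root; lia.
- by rewrite dzE !inE eqxx (eq_sym u) (negPf xu) /indz /=; lia.
- move=> [h [gh hn]]; exists (set_end h e (x, u)); split.
    by apply: (reor_set_end gh); case: ge => ->; [left|right].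
  move=> v /hn[l lE]; exists l; rewrite -lE net_set_end.
  have -> : (h e).1 = (h e).2 by apply: (reor_loop gh); rewrite /g' /set_end eqxx.
  by rewrite /i' /bump /= !(eq_sym v); lia.
Qed.

(* Lift the path u - x - w. *)
Lemma lift_pair (V E : finType) (m : int) (W : {set V}) (g : E -> V * V) t i o x e u f w :
  0 < m -> x \in W -> admissible m W [set x] g t i o -> slack m W g t i o ->
  joins g e x u -> joins g f x w -> e != f ->
  (u = w -> 2 * m + nu m (t u) <= degz g i o [set u]) ->
  exists g' : E -> V * V, [/\ admissible m W [set x] g' t i o,
     degz g' i o [set x] = degz g i o [set x] - 2 &
     extendable m W g' t i o -> extendable m W g t i o].
Proof.
move=> m0 xW [wf ge0 ex ex1 par [ls sumE] cut root] sl Je Jf ef uw.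
have [_ uW] := joins_wf wf Je; have [xu ge] := Je.
have [_ wW] := joins_wf wf Jf; have [xw gf] := Jf.
pose g1 := set_end g e (u, w); pose g' := set_end g1 f (x, x).
have g1f : g1 f = g f by rewrite /g1 /set_end eq_sym (negPf ef).
have dzE X : degz g' i o X = degz g i o X - indz ((x \in X) != (u \in X))
   - indz ((x \in X) != (w \in X)) + indz ((u \in X) != (w \in X)).
  rewrite /degz cutz_set_end g1f cutz_set_end (joins_crosses _ Je) (joins_crosses _ Jf).
  by rewrite crosses_loop /crosses /=; lia.
exists g'; split.
- split => //.
  + by apply: wf_set_end; [apply: wf_set_end => //; right|left].
  + move=> X XW; have [l lE] := par X XW; rewrite dzE lE; clear.
    by case: (x \in X); case: (u \in X); case: (w \in X); rewrite /indz /=;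
      first [exists l; lia | exists (l-1); lia].
  + by exists ls.
  + move=> X XW X0 XnW Xex; rewrite dzE; have := cut X XW X0 XnW Xex.
    have := sl X XW; have := @card_gt1_mem _ X x.
    have := Xex x; rewrite inE eqxx => /(_ isT) Xx.
    case: (boolP (x \in X)) => [_ /(_ isT Xx) -> /(_ isT XnW)|xX _].
      by clear; case: (u \in X); case: (w \in X); rewrite /indz /=; lia.
    (* A set without [x] loses degree only if it contains both [u] and [w]. The one such set that
       may escape [slack] is [[set u]] with [u = w], for which there is a hypothesis. *)
    case: (boolP (u \in X)) => uX; case: (boolP (w \in X)) => wX;
      try by clear; rewrite /indz /=; lia.
    have [Xu|Xu] := eqVneq X [set u]; last first.
      by rewrite (card_gt1_mem uX Xu) => /(_ isT XnW); clear; rewrite /indz /=; lia.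
    have wu : w = u by apply/eqP; move: wX; rewrite Xu inE.
    by have := uw (esym wu); rewrite Xu !sumon1; clear; rewrite /indz /=; lia.
  + by rewrite dzE xW uW wW /indz /=; move: root; lia.
- by rewrite dzE !inE eqxx (eq_sym u) (eq_sym w) (negPf xu) (negPf xw) /indz /=; lia.
- move=> [h [gh hn]].
  have hf : (h f).1 = (h f).2 by apply: (reor_loop gh); rewrite /g' /set_end eqxx.
  have hE : h e = (u, w) \/ h e = (w, u).
    by have := gh e; rewrite /g' /g1 /set_end eqxx (negPf ef).
  have ne p : set_end h e p f = h f by rewrite /set_end eq_sym (negPf ef).
  (* The direction of the lifted edge is passed on to the path through [x], which leaves all net
     outdegrees unchanged. *)
  have go pe pf : pe = g e \/ pe = ((g e).2, (g e).1) ->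
      pf = g f \/ pf = ((g f).2, (g f).1) ->
      (forall v, indz (pe.1 == v) - indz (pe.2 == v) + indz (pf.1 == v) - indz (pf.2 == v)
         = indz ((h e).1 == v) - indz ((h e).2 == v)) ->
      extendable m W g t i o.
    move=> He Hf Hn; exists (set_end (set_end h e pe) f pf); split.
      move=> e'; have := gh e'; rewrite /g' /g1 /set_end.
      case: (e' =P f) => [-> //|_]; by case: (e' =P e) => [-> //|].
    move=> v /hn[l lE]; exists l; rewrite -lE !net_set_end ne hf.
    by have := Hn v; lia.
  case: hE => hE.
  + apply: (go (u, x) (x, w)); first by case: ge => ->; [right|left].
      by case: gf => ->; [left|right].
    by move=> v; rewrite hE /=; lia.
  + apply: (go (x, u) (w, x)); first by case: ge => ->; [left|right].
      by case: gf => ->; [right|left].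
    by move=> v; rewrite hE /=; lia.
Qed.

(** The net outdegree 0 of an isolated vertex meets the demand of an exempt one, a multiple of
    [2 * m]; so [x] is dropped from [W]. *)
Lemma extend_isolated (V E : finType) (m : int) (W : {set V}) (g : E -> V * V) t i o x :
  0 < m -> x \in W -> admissible m W [set x] g t i o -> degz g i o [set x] = 0 ->
  (2 < #|W|)%N ->
  (forall (W' S' : {set V}) g' t' i' o', (1 < #|W'| < #|W|)%N ->
     @admissible V E m W' S' g' t' i' o' -> extendable m W' g' t' i' o') ->
  extendable m W g t i o.
Proof.
move=> m0 xW [wf ge0 ex ex1 par [ls sumE] cut root] dx W3 IH.
have [ix ox] := ge0 x; have cx := cutz_ge0 g [set x].
have [lx txE] := ex x (set11 x).
have [cx0 [ix0 ox0]] : cutz g [set x] = 0 /\ i x = 0 /\ o x = 0.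
  by move: dx; rewrite /degz !sumon1; lia.
have loop e : ((g e).1 == x) = ((g e).2 == x).
  have : crosses [set x] (g e) = 0.
    apply: (psumr_eq0P (P := predT)) (cx0) _ isT => e' _; exact: crosses_ge0.
  by rewrite /crosses !inE; case: (_ == x); case: (_ == x).
have xsub : [set x] \subset W by rewrite sub1set.
have smW f : sumon f (W :\ x) = sumon f W - f x by rewrite sumon_diff // sumon1.
have dzW : degz g i o (W :\ x) = degz g i o W.
  by rewrite /degz !smW cutz_compl // cx0; have := cutz_compl W wf; rewrite setDv cutz0; lia.
have nuW : nu m (sumon t (W :\ x)) = nu m (sumon t W).
  by apply: (@nu_cong _ _ _ (- lx)); rewrite smW txE; lia.
have cardW : #|W| = #|W :\ x|.+1 by rewrite (cardsD1 x) xW.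
have [||h [gh hn]] := IH (W :\ x) set0 g t i o; first by lia.
  split => //.
  - move=> e ne; have [e1 e2] := wf e ne; rewrite !inE e1 e2 !andbT.
    have := loop e; case: ((g e).1 =P x) => e1x; case: ((g e).2 =P x) => e2x // _.
    by rewrite e1x e2x eqxx in ne.
  - by move=> y; rewrite inE.
  - by move=> y z; rewrite inE.
  - by move=> X XW; apply: par; apply: subset_trans XW (subD1set _ _).
  - by exists (ls - lx); rewrite !smW; lia.
  - move=> X XW X0 XnW _.
    have xX : x \notin X by apply/negP => /(subsetP XW); rewrite !inE eqxx.
    apply: cut => //; first exact: subset_trans XW (subD1set _ _).
      by apply: contraNneq xX => ->.
    by move=> y /set1P ->; apply: contraNneq xX => ->; rewrite inE.
  - by rewrite dzW nuW.
exists h; split=> // v vW; have [->|vx] := eqVneq v x; last by apply: hn; rewrite !inE vx.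
exists (- lx); rewrite ix0 ox0 txE.
have -> : net h x = 0.
  by apply: big1 => e _; case: (gh e) => -> /=; rewrite (loop e) subrr.
lia.
Qed.

(** Each lifting at [x] lowers its degree by 2, until [x] is isolated. Since [[set x]] is exempt,
    nothing stops this descent. *)
Lemma extend_exempt (V E : finType) (m : int) (W : {set V}) (g : E -> V * V) t i o x :
  2 <= m -> x \in W -> (1 < #|W|)%N -> admissible m W [set x] g t i o ->
  (forall (W' S' : {set V}) g' t' i' o', (1 < #|W'| < #|W|)%N ->
     @admissible V E m W' S' g' t' i' o' -> extendable m W' g' t' i' o') ->
  extendable m W g t i o.
Proof.
move=> m2 xW W2 adm IH; have m0 : 0 < m by lia.
have [W3|W3] := ltnP 2 #|W|; last first.
  have /cards1P[y Wy] : #|W :\ x| == 1%N by move: (cardsD1 x W); rewrite xW; lia.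
  have yx : y \in W :\ x by rewrite Wy inE.
  have WE : W = [set x; y] by rewrite -(setD1K xW) Wy.
  rewrite WE in adm *; apply: (extend_two (S := [set x])) => //.
    by move: yx; rewrite !inE eq_sym => /andP[].
  by move: yx; rewrite !inE => /andP[].
have [n] := ubnP `|degz g i o [set x]|%N; elim: n => // n IHn in g t i o adm *.
rewrite ltnS => dn.
have [sl|//] := slack_or_extendable m0 adm IH.
have [wf ge0 ex ex1 par [ls sumE] cut root] := adm.
have [ix ox] := ge0 x.
have [lx txE] := ex x (set11 x).
have xsub : [set x] \subset W by rewrite sub1set.
have cardW : #|W| = #|W :\ x|.+1 by rewrite (cardsD1 x) xW.
(* The demands of [W :\ x] and [W] agree modulo [2 * m]; the cut condition of the former and the
   root bound show that at most half of the edges at [x] are root edges. *)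
have qp : i x + o x <= cutz g [set x].
  have : 2 * m - 2 + nu m (sumon t (W :\ x)) <= degz g i o (W :\ x).
    apply: cut; first exact: subD1set.
    - by rewrite -card_gt0; lia.
    - by apply/eqP => /setP/(_ x); rewrite !inE eqxx xW.
    - by move=> y /set1P ->; apply/eqP => /setP/(_ x); rewrite !inE eqxx.
  have -> : nu m (sumon t (W :\ x)) = nu m (sumon t W).
    by apply: (@nu_cong _ _ _ (- lx)); rewrite sumon_diff // sumon1 txE; lia.
  move: root; rewrite /degz !sumon_diff // !sumon1 cutz_compl //.
  by have := cutz_compl W wf; rewrite setDv cutz0; lia.
have dxE : degz g i o [set x] = cutz g [set x] + i x + o x by rewrite /degz !sumon1.
have [d0|dpos] := eqVneq (degz g i o [set x]) 0; first exact: (extend_isolated m0 xW adm d0).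
have cpos : 0 < cutz g [set x] by lia.
have [e [u J]] := cut1_joins cpos.
have [ipos|i0] : 0 < i x \/ i x = 0 by lia.
  have [g' [i' [adm' dz' ]]] := lift_root m0 xW adm sl J ipos; apply.
  by apply: IHn => //; lia.
have [opos|o0] : 0 < o x \/ o x = 0 by lia.
  have [g' [i' [adm' dz' trans]]] :=
    lift_root m0 xW (admissible_rev m0 adm) (slack_rev m0 sl) J opos.
  apply: extendable_rev; apply: trans; apply: IHn => //.
  have -> : degz g' i' i [set x] = degz g i o [set x] - 2 by rewrite dz' /degz; lia.
  lia.
(* The degree of [x] is even because its demand is, so a second edge [f] exists. *)
have [l lE] := par _ xsub.
rewrite sumon1 in lE.
have [f [w [Jf ef uw]]] : exists f w, [/\ joins g f x w, e != f &
    u = w -> 2 * m + nu m (t u) <= degz g i o [set u]].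
  case: (boolP [exists f, [exists w, [&& w != x, w != u &
       (g f == (x, w)) || (g f == (w, x))]]]).
    case/existsP=> f /existsP[w /and3P[wx wu /orP gf]]; exists f, w.
    have Jf : joins g f x w by split; [rewrite eq_sym|case: gf => /eqP ->; tauto].
    split => //; last by move=> uw; rewrite uw eqxx in wu.
    apply: contraNneq wu => ef; have := joins_crosses [set w] J.
    rewrite ef (joins_crosses _ Jf) !inE eqxx (eq_sym x) (negPf wx) (eq_sym u).
    by case: (w == u).
  rewrite negb_exists => /forallP H.
  have onlyu f w : joins g f x w -> w = u.
    move=> [xw gf]; have := H f; rewrite negb_exists => /forallP/(_ w).
    rewrite eq_sym xw /=; case: eqP => //= _.
    by case: gf => ->; rewrite eqxx ?orbT.
  have [|f [w Jf']] := @cut1_joins _ _ (set_end g e (x, x)) x.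
    rewrite cutz_set_end (joins_crosses _ J) crosses_loop !inE eqxx (eq_sym u).
    by have [/negPf -> _] := J; rewrite /indz /=; lia.
  have ef : e != f.
    by apply/eqP => ef; have := joins_neq Jf'; rewrite ef /set_end eqxx /= eqxx.
  have Jf : joins g f x w by move: Jf'; rewrite /joins /set_end (eq_sym f) (negPf ef).
  exists f, w; split => // _.
  have [xu _] := J; have [_ uW] := joins_wf wf J.
  (* All edges at [x] lead to [u]. The degree of [u] thus exceeds that of [[set x; u]], a set that
     has slack because [W] has at least three vertices. *)
  have cux : cutz g [set x; u] = cutz g [set u] - cutz g [set x].
    rewrite /cutz -sumrB; apply: eq_bigr => e' _; rewrite /crosses !inE.
    case: ((g e').1 =P x) => [e1|/eqP e1]; case: ((g e').2 =P x) => [e2|/eqP e2] //=.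
    - by rewrite e1 e2 eqxx.
    - have <- : (g e').2 = u.
        by apply: (onlyu e'); split; [rewrite eq_sym|left; rewrite -e1; case: (g e')].
      by rewrite eqxx e1 (eq_sym x) (negPf e2).
    - have <- : (g e').1 = u.
        by apply: (onlyu e'); split; [rewrite eq_sym|right; rewrite -e2; case: (g e')].
      by rewrite eqxx e2 (eq_sym x) (negPf e1).
    - by rewrite subr0.
  have := sl [set x; u]; rewrite subUset xsub sub1set uW cards2 xu.
  have nW : [set x; u] != W by apply: contraTneq W3 => <-; rewrite cards2 xu.
  move=> /(_ isT isT nW); rewrite /degz !sumon2 // cux !sumon1.
  have -> : nu m (t x + t u) = nu m (t u) by apply: (@nu_cong _ _ _ lx); lia.
  lia.
have [g' [adm' dz']] := lift_pair m0 xW adm sl J Jf ef uw; apply.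
by apply: IHn => //; lia.
Qed.

(** * Graphs without an exempt vertex *)

Lemma nu_step (m z : int) : 0 < m ->
  exists w l : int, [/\ z = w + 2 * m * l, - m < w <= m, nu m z = `|w|,
    nu m (z - 1) = `|w - 1| & nu m (z + 1) = if w == m then m - 1 else `|w + 1| ].
Proof.
move=> m0; have [w [l [zE w1 w2 nuE]]] := nu_rep z m0.
exists w, l; split => //; first by rewrite w1 w2.
  by rewrite (@nu_cong _ _ (w - 1) l) ?nu_small //; lia.
case: eqP => [wm|wm].
  by rewrite (@nu_cong _ _ (1 - m) (l + 1)) ?nu_small //; lia.
by rewrite (@nu_cong _ _ (w + 1) l) ?nu_small //; lia.
Qed.

(* Orient e from x to y and delete it, adding a edges from y to the root and b
   edges from the root to y. *)
Lemma remove_edge (V E : finType) (m : int) (W : {set V}) (g : E -> V * V) t i o e x y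
    (a b : int) :
  0 < m -> admissible m W set0 g t i o -> slack m W g t i o ->
  joins g e x y -> 0 <= a -> 0 <= b ->
  2 * m - 1 + nu m (t x - 1) <= degz g i o [set x] ->
  2 * m - 1 + nu m (t y + 1 + a - b) <= degz g i o [set y] + a + b ->
  degz g i o W + a + b <= 2 * m - 2 + nu m (sumon t W + a - b) ->
  exists (g' : E -> V * V) t' i' o', [/\ admissible m W set0 g' t' i' o',
     (#|nonloops g'| < #|nonloops g|)%N &
     extendable m W g' t' i' o' -> extendable m W g t i o].
Proof.
move=> m0 [wf ge0 ex ex1 par [ls sumE] cut root] sl J a0 b0 hx hy hW.
have [xW yW] := joins_wf wf J; have [xy ge] := J.
pose g' := set_end g e (x, x); pose t' := bump x (-1) (bump y (1 + a - b) t).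
pose i' := bump y b i; pose o' := bump y a o.
have dzE X : degz g' i' o' X = degz g i o X - indz ((x \in X) != (y \in X))
   + indz (y \in X) * (a + b).
  rewrite /degz /i' /o' !sumon_bump cutz_set_end (joins_crosses _ J) crosses_loop; lia.
have tE X : sumon t' X = sumon t X - indz (x \in X) + indz (y \in X) * (1 + a - b).
  rewrite /t' !sumon_bump; lia.
exists g', t', i', o'; split.
- split.
  + by apply: wf_set_end => //; left.
  + move=> v; have [iv ov] := ge0 v; rewrite /i' /o' /bump /indz.
    by case: (v == y) => /=; lia.
  + by move=> z; rewrite inE.
  + by move=> z u; rewrite inE.
  + move=> X XW; have [l lE] := par X XW; rewrite dzE tE lE; clear.
    case: (x \in X); case: (y \in X); rewrite /indz /=;
      [exists (l+b)|exists l|exists (l-1+b)|exists l]; lia.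
  + by exists ls; rewrite tE /i' /o' !sumon_bump xW yW /indz /= sumE; lia.
  (* The new root edges at [y] pay for the change [a - b] of the demand. What remains, one lost edge
     and one unit of demand, is covered by [slack] except at [[set x]] and [[set y]]. *)
  + move=> X XW X0 XnW _; rewrite dzE tE.
    have cutX : 2 * m - 2 + nu m (sumon t X) <= degz g i o X.
      by apply: cut => // z; rewrite inE.
    have slX : forall z, z \in X -> X != [set z] -> 2 * m + nu m (sumon t X) <= degz g i o X.
      by move=> z zX Xz; apply: sl => //; apply: card_gt1_mem zX Xz.
    case: (boolP (x \in X)) => xX; case: (boolP (y \in X)) => yX;
      rewrite /= ?indzT ?indzF ?mul0r ?mul1r ?addr0 ?subr0.
    * have := nuD_norm (sumon t X) (a - b) m0.
      rewrite (_ : sumon t X - 1 + (1 + a - b) = sumon t X + (a - b)); last by lia.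
      by move: cutX a0 b0; clear; lia.
    * have [Xx|Xx] := eqVneq X [set x]; first by rewrite Xx sumon1; move: hx; clear; set u := nu _ _; lia.
      have := slX _ xX Xx; have := nuD_norm (sumon t X) (-1) m0; clear.
      by set u := nu m (sumon t X - 1); lia.
    * have [Xy|Xy] := eqVneq X [set y].
        rewrite Xy sumon1 (_ : t y + _ = t y + 1 + a - b); last by lia.
        by move: hy; clear; lia.
      have := slX _ yX Xy; have := nuD_norm (sumon t X) (1 + a - b) m0.
      by move: a0 b0; clear; lia.
    * by [].
  + rewrite dzE tE xW yW /= indzT indzF !mul1r subr0 (_ : _ + (1 + a - b) = sumon t W + a - b); last by lia.
    by move: hW; clear; lia.
- by apply: nonloops_set_end; apply: joins_neq J.
- move=> [h [gh hn]]; exists (set_end h e (x, y)); split.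
    by apply: (reor_set_end gh); case: ge => ->; [left|right].
  move=> v /hn[l lE]; exists l; move: lE; rewrite net_set_end.
  have -> : (h e).1 = (h e).2 by apply: (reor_loop gh); rewrite /g' /set_end eqxx.
  by rewrite /i' /o' /t' /bump /= !(eq_sym v); clear; lia.
Qed.

(** Deleting an edge that enters [w] from the root raises the demand left at [w] by one. The root
    bound persists since [nu] drops by at most one. *)
Lemma remove_root_edge (V E : finType) (m : int) (W : {set V}) (g : E -> V * V) t i o w :
  0 < m -> admissible m W set0 g t i o -> slack m W g t i o -> w \in W -> 0 < i w ->
  2 * m - 1 + nu m (t w + 1) <= degz g i o [set w] ->
  admissible m W set0 g (bump w 1 t) (bump w (-1) i) o /\
  (extendable m W g (bump w 1 t) (bump w (-1) i) o -> extendable m W g t i o).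
Proof.
move=> m0 [wf ge0 ex ex1 par [ls sumE] cut root] sl wW iw hw.
have dzE X : degz g (bump w (-1) i) o X = degz g i o X - indz (w \in X).
  by rewrite /degz sumon_bump; lia.
split; last first.
  move=> [h [gh hn]]; exists h; split => // v /hn[l lE]; exists l.
  by move: lE; rewrite /bump; clear; lia.
split => //.
- move=> v; have [iv ov] := ge0 v; split => //; rewrite /bump /indz.
  by have [->|] := eqVneq v w => /=; lia.
- by move=> z; rewrite inE.
- move=> X XW; have [l lE] := par X XW; exists (l - indz (w \in X)).
  by rewrite dzE sumon_bump lE; clear; lia.
- by exists ls; rewrite !sumon_bump wW /indz /= sumE; lia.
- move=> X XW X0 XnW Xex; rewrite dzE sumon_bump.
  have cutX := cut X XW X0 XnW Xex.
  have := nuD_norm (sumon t X) 1 m0.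
  have [wX|wX] := boolP (w \in X); rewrite /= ?indzT ?indzF ?mul0r ?addr0 ?mul1r ?subr0; last first.
    by move: cutX; clear; lia.
  have [Xw|Xw] := eqVneq X [set w].
    by rewrite Xw sumon1; move: hw; clear; lia.
  by have := sl X XW (card_gt1_mem wX Xw) XnW; clear; lia.
- rewrite dzE sumon_bump wW indzT mul1r.
  have := nuD_norm (sumon t W + 1) (-1) m0; rewrite addrK.
  by move: root; clear; lia.
Qed.

(* v may lose an edge, its demand changing by c, without violating adm_cut. *)
Definition losable (V E : finType) (m : int) (g : E -> V * V) t i o (c : int) (v : V) :=
  2 * m - 1 + nu m (t v + c) <= degz g i o [set v].

Lemma losable_rev (V E : finType) (m : int) (g : E -> V * V) t i o c (v : V) :
  0 < m -> losable m g (fun v => - t v) o i c v = losable m g t i o (- c) v.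
Proof.
move=> m0; rewrite /losable -[nu m (t v - c)]nuN // opprB addrC.
by congr (_ <= _); [rewrite addrC (addrC c)|rewrite /degz addrAC].
Qed.

(** The cut conditions of [X] and [W :\: X], the root bound and subadditivity of [nu] give
    [2 * m - 2 <= 2 * cutz g X]. *)
Lemma cut_pos (V E : finType) (m : int) (W : {set V}) (g : E -> V * V) t i o (X : {set V}) :
  2 <= m -> admissible m W set0 g t i o -> X \subset W -> X != set0 -> X != W ->
  0 < cutz g X.
Proof.
move=> m2 [wf ge0 ex ex1 par [ls sumE] cut root] XW X0 XnW.
have m0 : 0 < m by lia.
have := cut X XW X0 XnW; have := cut (W :\: X) (subsetDl _ _).
have e0 (Y : {set V}) x : x \in set0 -> Y != [set x] by rewrite inE.
have Xc0 : W :\: X != set0.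
  by apply: contraNneq XnW => /eqP; rewrite setD_eq0 eqEsubset XW.
have XcW : W :\: X != W.
  have /set0Pn[v vX] := X0; apply/eqP => /setP/(_ v).
  by rewrite !inE vX (subsetP XW).
move=> /(_ Xc0 XcW (e0 _)) c1 /(_ (e0 _)) c2.
have := nuD (sumon t X) (sumon t (W :\: X)) m0.
rewrite sumon_diff // in c1 *; rewrite subrKC.
have := cutz_compl W wf; rewrite setDv cutz0 => cW.
move: c1 c2 root; rewrite /degz !sumon_diff // cutz_compl // -cW; move: m2; clear; lia.
Qed.

(** Orienting and deleting an edge costs its tail an outgoing and its head an incoming edge. Once
    tight vertices with demand 0 are disposed of, every vertex can afford one of these losses; the
    hard case is that of two adjacent vertices that can afford only the same one. *)
Lemma extend_no_exempt (V E : finType) (m : int) (W : {set V}) (g : E -> V * V) t i o :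
  2 <= m -> (1 < #|W|)%N -> admissible m W set0 g t i o ->
  (forall (W' S' : {set V}) g' t' i' o', (1 < #|W'| < #|W|)%N ->
     @admissible V E m W' S' g' t' i' o' -> extendable m W' g' t' i' o') ->
  extendable m W g t i o.
Proof.
move=> m2 W2 adm0 IH; have m0 : 0 < m by lia.
have /card_gt0P[x0 x0W] : (0 < #|W|)%N by apply: leq_trans W2.
have [W3|W3] := ltnP 2 #|W|; last first.
  have /cards1P[y Wy] : #|W :\ x0| == 1%N by move: (cardsD1 x0 W); rewrite x0W; lia.
  have yx : y \in W :\ x0 by rewrite Wy inE.
  have WE : W = [set x0; y] by rewrite -(setD1K x0W) Wy.
  rewrite WE in adm0 *; apply: (extend_two (S := set0)); rewrite ?inE //.
  by move: yx; rewrite !inE eq_sym => /andP[].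
have [n] := ubnP #|nonloops g|; elim: n => // n IHn in g t i o adm0 *; rewrite ltnS => gn.
(* The root degree is only the secondary measure: deleting an edge may add root edges. *)
have [k] := ubnP `|(sumon i W + sumon o W)%R|%N; elim: k => // k IHk in t i o adm0 *; rewrite ltnS => kn.
have [sl0|//] := slack_or_extendable m0 adm0 IH.
have step t' i' o' e x y (a b : int) : admissible m W set0 g t' i' o' ->
  slack m W g t' i' o' -> joins g e x y -> 0 <= a -> 0 <= b ->
  2 * m - 1 + nu m (t' x - 1) <= degz g i' o' [set x] ->
  2 * m - 1 + nu m (t' y + 1 + a - b) <= degz g i' o' [set y] + a + b ->
  degz g i' o' W + a + b <= 2 * m - 2 + nu m (sumon t' W + a - b) ->
  extendable m W g t' i' o'.
  move=> adm sl J a0 b0 hx hy hW.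
  have [g1 [t1 [i1 [o1 [adm1 g1n]]]]] := remove_edge m0 adm sl J a0 b0 hx hy hW; apply.
  by apply: IHn => //; apply: leq_trans g1n gn.
have swap t' i' o' e x y : admissible m W set0 g t' i' o' ->
  slack m W g t' i' o' -> joins g e x y -> losable m g t' i' o' (-1) x ->
  losable m g t' i' o' 1 y -> extendable m W g t' i' o'.
  move=> adm sl J hx hy; apply: (step _ _ _ _ _ _ 0 0 adm sl J) => //.
    by rewrite !addr0 ?subr0.
  by rewrite !addr0 ?subr0; apply: adm_root adm.
have rem t' i' o' w : admissible m W set0 g t' i' o' -> slack m W g t' i' o' ->
    (`|(sumon i' W + sumon o' W)%R| <= k)%N -> w \in W -> 0 < i' w -> losable m g t' i' o' 1 w ->
    extendable m W g t' i' o'.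
  move=> adm sl kn' wW iw hw.
  have [adm1] := remove_root_edge m0 adm sl wW iw hw; apply.
  apply: IHk => //; rewrite sumon_bump wW.
  have : i' w <= sumon i' W + sumon o' W.
    have nn (f : V -> int) : (forall v, 0 <= f v) -> 0 <= sumon f (W :\ w).
      by move=> f0; apply: sumr_ge0 => v _.
    have smw (f : V -> int) : sumon f W = f w + sumon f (W :\ w) by rewrite /sumon (big_setD1 w).
    rewrite !smw; have := nn i' (fun v => (adm_ge0 adm v).1).
    have := nn o' (fun v => (adm_ge0 adm v).2); have := (adm_ge0 adm w).2.
    clear; lia.
  by move: kn' iw; rewrite /indz /=; clear; lia.
(* A tight vertex with demand 0 becomes the exempt vertex. *)
case: (boolP [exists v in W, (degz g i o [set v] == 2 * m - 2 + nu m (t v)) &&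
    (nu m (t v) == 0)]).
  case/exists_inP => v vW /andP[_ /eqP nu0].
  apply: (extend_exempt m2 vW W2) => //; have [wf ge0 ex ex1 par sumE cut root] := adm0.
  split => //.
  - move=> x /set1P ->; have [w [l [tE _ _ nuE]]] := nu_rep (t v) m0; exists l.
    by rewrite tE (_ : w = 0) ?add0r //; move: nu0; rewrite nuE; clear; lia.
  - by move=> x y /set1P -> /set1P ->.
  - by move=> X XW X0 XnW _; apply: cut => // x; rewrite inE.
rewrite negb_exists => /forallP nonzero.
have tight v : v \in W -> 2 * m - 2 + nu m (t v) <= degz g i o [set v].
  move=> vW; rewrite -sumon1; apply: (adm_cut adm0).
  - by rewrite sub1set.
  - by apply/set0Pn; exists v; rewrite inE.
  - by apply: contraTneq W3 => <-; rewrite cards1.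
  - by move=> x; rewrite inE.
have parity v : v \in W -> exists l : int, degz g i o [set v] = t v + 2 * l.
  by move=> vW; have := @adm_par _ _ _ _ _ _ _ _ _ adm0 [set v];
    rewrite sub1set sumon1; apply.
(* At a tight vertex the demand is nonzero, and a step towards 0 pays for the lost edge. At any
   other vertex parity leaves 2 to spare. *)
have lose1 v : v \in W -> losable m g t i o (-1) v || losable m g t i o 1 v.
  move=> vW; have := nonzero v; rewrite vW /= negb_and.
  have := tight v vW; have [l lE] := parity v vW.
  rewrite /losable; have [w [l' [tE wm nu1 -> ->]]] := nu_step (t v) m0.
  rewrite nu1 lE; have : t v = w + 2 * (m * l') by rewrite tE; lia.
  by move: wm m0; clear; case: (w =P m) => ?; lia.
(* Neither x nor y may lose an incoming edge.  If the root has room for one more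
     outgoing edge, replace xy by an edge from the root to y.  Otherwise this
     holds at every vertex, all root edges leave the root, and their number forces
     t W = 1 modulo 2m; then y can be given demand m by adding edges to the root. *)
have main t' i' o' e x y : admissible m W set0 g t' i' o' -> slack m W g t' i' o' ->
    (`|(sumon i' W + sumon o' W)%R| <= k)%N ->
    (forall v, v \in W -> losable m g t' i' o' (-1) v || losable m g t' i' o' 1 v) ->
    joins g e x y ->
    ~~ losable m g t' i' o' 1 x -> ~~ losable m g t' i' o' 1 y ->
    extendable m W g t' i' o'.
  move=> adm sl kn' lose J nx ny.
  have [wf ge0 _ _ par [ls sumE] cut root] := adm.
  have [xW yW] := joins_wf wf J.
  have gx : losable m g t' i' o' (-1) x by have := lose x xW; rewrite (negPf nx) orbF.
  have gy : losable m g t' i' o' (-1) y by have := lose y yW; rewrite (negPf ny) orbF.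
  have tighty : 2 * m - 2 + nu m (t' y) <= degz g i' o' [set y].
    rewrite -sumon1; apply: cut.
    - by rewrite sub1set.
    - by apply/set0Pn; exists y; rewrite inE.
    - by apply: contraTneq W3 => <-; rewrite cards1.
    - by move=> z; rewrite inE.
  have [hW|hW] := leP (degz g i' o' W + 1) (2 * m - 2 + nu m (sumon t' W - 1)).
    apply: (step _ _ _ _ _ _ 0 1 adm sl J) => //.
      by rewrite !addr0 addrK; move: tighty; clear; lia.
    by rewrite !addr0.
  (* If [P] is not [W], some edge leaves it, and [swap] applies: the end in [P] can lose an outgoing
     edge, the other end an incoming one. *)
  pose P := [set v in W | ~~ losable m g t' i' o' 1 v].
  have PW : P \subset W by apply/subsetP => v; rewrite inE => /andP[].
  have [PE|PnW] := eqVneq P W; last first.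
    have P0 : P != set0 by apply/set0Pn; exists x; rewrite inE xW.
    have [f [u [v [Jf]]]] := cut_joins (cut_pos m2 adm PW P0 PnW).
    have [uW vW] := joins_wf wf Jf; rewrite !inE uW vW /= negbK => nu gv.
    by apply: (swap _ _ _ _ _ _ adm sl Jf) gv; have := lose u uW; rewrite (negPf nu) orbF.
  case: (boolP [exists w in W, 0 < o' w]).
    case/exists_inP => w wW ow.
    apply: extendable_rev; apply: (rem _ _ _ _ (admissible_rev m0 adm) (slack_rev m0 sl) _ wW ow).
      by rewrite addrC.
    rewrite losable_rev //; have := lose w wW.
    by move: wW; rewrite -PE inE => /andP[_ /negPf ->]; rewrite orbF.
  rewrite negb_exists => /forallP no.
  have o0 : sumon o' W = 0.
    apply: big1 => v vW; have := no v; rewrite vW /=; have := (ge0 v).2; clear; lia.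
  have dW : degz g i' o' W = sumon i' W.
    by rewrite /degz o0; have := cutz_compl W wf; rewrite setDv cutz0; clear; lia.
  have [l parW] := par W (subxx _).
  have [w [l1 [tE w1 nu1 nu2 nu3]]] := nu_step (sumon t' W) m0.
  have [w' [l2 [tyE w1' nu1' nu2' nu3']]] := nu_step (t' y) m0.
  (* Since the root has no room for one more edge, [w] is positive and [sumon i' W = 2 * m - 2 + w].
     As all root edges enter [W], [w] is congruent to minus this number, so [w = 1] modulo [m]. *)
  have w1E : w = 1.
    have : sumon t' W = w + 2 * (m * l1) by rewrite tE; lia.
    have : sumon t' W = - sumon i' W + 2 * (m * ls) by rewrite sumE o0; lia.
    have key c : 0 < w <= m -> w = m * c + 1 -> w = 1.
      move=> w0 wE; have [c0|[c1|c1]] : c = 0 \/ (1 <= c \/ c <= -1) by lia.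
      - by rewrite wE c0 mulr0.
      - by have : m * 1 <= m * c by [rewrite ler_pM2l]; move: w0 wE m2; clear; lia.
      - by have : m * c <= m * -1 by [rewrite ler_pM2l]; move: w0 wE m2; clear; lia.
    move: root hW parW; rewrite dW nu2 nu1 => r1 r2 r3 s1 s2.
    have w0 : 0 < w by move: r1 r2 w1; clear; lia.
    apply: (key (ls - l1 - 1)); first by rewrite w0; case/andP: w1.
    have : sumon i' W = 2 * m - 2 + w.
      move: r1 r2 r3 w0 s1 s2; clear; lia.
    by move: s1 s2; clear; lia.
  have [l' lE] := par [set y] ltac:(by rewrite sub1set).
  (* Only lowering the demand of [y] reduces its [nu], so [w'] is positive, and it is not [m], from
     where both steps reduce it. Moreover [y] is tight. *)
  have w'b : 1 <= w' < m.
    move: gy ny tighty lE; rewrite /losable nu1' nu2' nu3' sumon1 => h1 h2 h3 h4.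
    have : t' y = w' + 2 * (m * l2) by rewrite tyE; lia.
    by move: h1 h2 h3 h4 w1' m2; clear; case: (w' =P m) => ?; lia.
  have dyE : degz g i' o' [set y] = 2 * m - 2 + w'.
    move: gy ny tighty lE; rewrite /losable nu1' nu2' nu3' sumon1 => h1 h2 h3 h4.
    have : t' y = w' + 2 * (m * l2) by rewrite tyE; lia.
    by move: h1 h2 h3 h4 w'b m2; clear; case: (w' =P m) => ?; lia.
  (* The demand of [y] becomes [m + 1], at distance [m - 1] from the multiples of [2 * m]. The
     bounds at [y] and at the root then hold with equality. *)
  apply: (step _ _ _ _ _ _ (m - w') 0 adm sl J) => //.
  - by move: w'b; clear; lia.
  - rewrite subr0 addr0 (@nu_cong _ _ (1 - m) (l2 + 1)); last by rewrite tyE; lia.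
    rewrite nu_small //; last by move: m2; clear; lia.
    by rewrite dyE; move: w'b; clear; lia.
  - rewrite addr0 subr0 (@nu_cong _ _ (1 + m - w') l1); last by rewrite tE w1E; lia.
    rewrite nu_small //; last by move: w'b; clear; lia.
    by move: root w'b; rewrite nu1 w1E; clear; lia.
have x0c : 0 < cutz g [set x0].
  apply: (cut_pos m2 adm0); rewrite ?sub1set //.
    by apply/set0Pn; exists x0; rewrite inE.
  by apply: contraTneq W3 => <-; rewrite cards1.
have [e [y J]] := cut1_joins x0c.
have [_ yW] := joins_wf (adm_wf adm0) J.
case: (boolP (losable m g t i o 1 x0)) => gx; case: (boolP (losable m g t i o 1 y)) => gy.
- case: (boolP (losable m g t i o (-1) x0)) => gx'; first exact: (swap _ _ _ _ _ _ adm0 sl0 J).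
  case: (boolP (losable m g t i o (-1) y)) => gy'.
    exact: (swap _ _ _ _ _ _ adm0 sl0 (joinsC J)).
  apply: extendable_rev.
  apply: (main _ _ _ _ _ _ (admissible_rev m0 adm0) (slack_rev m0 sl0) _ _ J);
    rewrite ?losable_rev ?opprK //; first by rewrite addrC.
  by move=> v vW; rewrite !losable_rev // opprK orbC lose1.
- apply: (swap _ _ _ _ _ _ adm0 sl0 (joinsC J)) => //.
  by have := lose1 y yW; rewrite (negPf gy) orbF.
- apply: (swap _ _ _ _ _ _ adm0 sl0 J) => //.
  by have := lose1 x0 x0W; rewrite (negPf gx) orbF.
- exact: (main _ _ _ _ _ _ adm0 sl0 _ lose1 J).
Qed.

(* The theorem of Lovasz, Thomassen, Wu and Zhang on modulo orientations, in the
   form that is suited to induction. *)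
Lemma extendable_admissible (V E : finType) (m : int) (W S : {set V}) (g : E -> V * V) t i o :
  2 <= m -> (1 < #|W|)%N -> admissible m W S g t i o -> extendable m W g t i o.
Proof.
move=> m2; have [n] := ubnP #|W|; elim: n => // n IH in W S g t i o *.
rewrite ltnS => Wn W2 adm.
have {}IH (W' S' : {set V}) g' t' i' o' : (1 < #|W'| < #|W|)%N ->
     @admissible V E m W' S' g' t' i' o' -> extendable m W' g' t' i' o'.
  by case/andP=> W'2 W'W; apply: IH => //; apply: leq_trans W'W Wn.
have [S0|/set0Pn[x xS]] := eqVneq S set0.
  by rewrite S0 in adm; apply: extend_no_exempt adm IH.
have SE : S = [set x].
  by apply/setP => y; rewrite inE; apply/idP/eqP => [yS|->//]; apply: (adm_exempt1 adm).
rewrite SE in adm; have [xW|xW] := boolP (x \in W).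
  exact: extend_exempt adm IH.
apply: extend_no_exempt IH => //; have [wf ge0 ex ex1 par sumE cut root] := adm.
split => // [y|y z|X XW X0 XnW _]; rewrite ?inE //; apply: cut => // y /set1P ->.
by apply: contraNneq xW => Xx; apply: (subsetP XW); rewrite Xx inE.
Qed.

(** * Two disjoint connected spanning subgraphs *)

Definition innz (V E : finType) (g : E -> V * V) (F : {set E}) (X : {set V}) : int :=
  \sum_e indz [&& e \in F, (g e).1 \in X & (g e).2 \in X].

(** For edges inside [W] this characterizes the unions of two forests; sets [X] with equality are
    the tight ones. *)
Definition sparse (V E : finType) (g : E -> V * V) (F : {set E}) (W : {set V}) : bool :=
  [forall X : {set V}, (X \subset W) && (X != set0) ==>
     (innz g F X <= 2 * #|X|%:Z - 2)].

Definition connects (V E : finType) (g : E -> V * V) (A : {set E}) (W : {set V}) :=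
  forall X : {set V}, X \subset W -> X != set0 -> X != W ->
    exists2 e, e \in A & ((g e).1 \in X) != ((g e).2 \in X).

Lemma sparseP (V E : finType) (g : E -> V * V) (F : {set E}) (W X : {set V}) :
  sparse g F W -> X \subset W -> X != set0 -> innz g F X <= 2 * #|X|%:Z - 2.
Proof. by move=> /forallP/(_ X)/implyP H XW X0; apply: H; rewrite XW. Qed.

Lemma indz_ge0 b : 0 <= indz b.
Proof. by case: b. Qed.

Lemma innz_ge0 (V E : finType) (g : E -> V * V) F (X : {set V}) : 0 <= innz g F X.
Proof. by apply: sumr_ge0 => e _; apply: indz_ge0. Qed.

Lemma innz_supermod (V E : finType) (g : E -> V * V) (F : {set E}) (X Y : {set V}) :
  innz g F X + innz g F Y <= innz g F (X :|: Y) + innz g F (X :&: Y).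
Proof.
rewrite /innz -!big_split /=; apply: ler_sum => e _; rewrite !inE.
case: (e \in F) => //=.
by case: ((g e).1 \in X); case: ((g e).1 \in Y); case: ((g e).2 \in X); case: ((g e).2 \in Y).
Qed.

(** Supermodularity of [innz]; the common vertex [z] makes the sparsity bound available for the
    intersection. *)
Lemma tightU (V E : finType) (g : E -> V * V) (F : {set E}) (W X Y : {set V}) z :
  sparse g F W -> X \subset W -> Y \subset W -> z \in X -> z \in Y ->
  innz g F X = 2 * #|X|%:Z - 2 -> innz g F Y = 2 * #|Y|%:Z - 2 ->
  innz g F (X :|: Y) = 2 * #|X :|: Y|%:Z - 2.
Proof.
move=> sp XW YW zX zY tX tY.
have I0 : X :&: Y != set0 by apply/set0Pn; exists z; rewrite inE zX.
have U0 : X :|: Y != set0 by apply/set0Pn; exists z; rewrite inE zX.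
have := sparseP sp (subset_trans (subsetIl X Y) XW) I0.
have UW : X :|: Y \subset W by rewrite subUset XW.
have := sparseP sp UW U0; have := innz_supermod g F X Y.
have := cardsUI X Y; rewrite tX tY; clear; lia.
Qed.

Lemma connects_add (V E : finType) (g g' : E -> V * V) (A' A : {set E}) (W : {set V}) e v a :
  v \in W -> connects g' A' (W :\ v) -> joins g e v a -> e \in A -> a \in W ->
  (forall X : {set V}, e \in A -> forall e', e' \in A' -> ((g' e').1 \in X :\ v) != ((g' e').2 \in X :\ v) ->
     exists2 f, f \in A & ((g f).1 \in X) != ((g f).2 \in X)) ->
  connects g A W.
Proof.
move=> vW con J eA aW H X XW X0 XnW.
have [va ge] := J.
have cr : (v \in X) != (a \in X) -> exists2 f, f \in A & ((g f).1 \in X) != ((g f).2 \in X).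
  by move=> vaX; exists e => //; case: ge => -> //=; rewrite eq_sym.
have XvW : X :\ v \subset W :\ v by apply: setSD.
have [Xv0|Xv0] := eqVneq (X :\ v) set0.
  apply: cr; have aX : a \in X = false.
    apply/negbTE/negP => aX; have : a \in X :\ v by rewrite !inE eq_sym va.
    by rewrite Xv0 inE.
  rewrite aX; have /set0Pn[z zX] := X0; have [<-|zv] := eqVneq z v; first by rewrite zX.
  by have : z \in X :\ v by [rewrite !inE zv]; rewrite Xv0 inE.
have [XvW'|XvW'] := eqVneq (X :\ v) (W :\ v).
  apply: cr; have aX : a \in X.
    have : a \in W :\ v by rewrite !inE eq_sym va.
    by rewrite -XvW' !inE => /andP[].
  rewrite aX; apply: contraNneq XnW => vX; rewrite eqEsubset XW /=.
  apply/subsetP => z zW; have [->|zv] := eqVneq z v; first by rewrite vX.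
  by have : z \in W :\ v by [rewrite !inE zv]; rewrite -XvW' !inE => /andP[].
have [e' e'A' cr'] := con _ XvW Xv0 XvW'.
exact: H cr'.
Qed.

Lemma card_sum_indz (T : finType) (X : {set T}) : #|X|%:Z = \sum_x indz (x \in X).
Proof.
rewrite -sum1_card big_mkcond (big_morph Posz PoszD (erefl 0%:Z)).
by apply: eq_bigr => e _; rewrite /indz; case: (_ \in _).
Qed.

Section Degree.
Variables (V E : finType) (g : E -> V * V) (F : {set E}) (W : {set V}).
Hypothesis FW : forall e, e \in F -> (g e).1 \in W /\ (g e).2 \in W.
Hypothesis spF : sparse g F W.

Definition star v := [set e in F | ((g e).1 == v) || ((g e).2 == v)].

Lemma sparse_loopless e : e \in F -> (g e).1 != (g e).2.
Proof.
move=> eF; apply/eqP => ge; have [gW _] := FW eF.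
have := sparseP spF (X := [set (g e).1]); rewrite sub1set gW cards1 => /(_ isT).
have n0 : [set (g e).1] != set0 by apply/set0Pn; exists (g e).1; rewrite inE.
move=> /(_ n0); rewrite /innz (bigD1 e) //= eF -ge !inE eqxx /=.
have : 0 <= \sum_(i | i != e) indz [&& i \in F, (g i).1 \in [set (g e).1]
     & (g i).2 \in [set (g e).1]] by apply: sumr_ge0 => e' _; apply: indz_ge0.
by rewrite ge indzT; set s := \sum_(_ | _) _; lia.
Qed.

Lemma star_joins v e : e \in star v -> exists2 a, joins g e v a & a \in W /\ a != v.
Proof.
rewrite inE => /andP[eF /orP[] /eqP ev]; have := sparse_loopless eF; have [g1 g2] := FW eF.
  move=> ne; exists (g e).2; last by rewrite eq_sym -ev.
  by split; [rewrite -ev|left; rewrite -ev; case: (g e)].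
move=> ne; exists (g e).1; last by rewrite -ev.
by split; [rewrite -ev eq_sym|right; rewrite -ev; case: (g e)].
Qed.

Lemma innz_full : innz g F W = #|F|%:Z.
Proof.
rewrite card_sum_indz; apply: eq_bigr => e _; congr indz.
by case: (boolP (e \in F)) => //= /FW[-> ->].
Qed.

Lemma star_card v : #|star v|%:Z = innz g F W - innz g F (W :\ v).
Proof.
rewrite card_sum_indz /innz -sumrB; apply: eq_bigr => e _; rewrite !inE.
case: (boolP (e \in F)) => //= /FW[-> ->]; rewrite !andbT.
by case: (_ == v); case: (_ == v).
Qed.

(** The degrees add up to [4 * #|W| - 4]. *)
Lemma small_star : (0 < #|W|)%N -> innz g F W = 2 * #|W|%:Z - 2 ->
  exists2 v, v \in W & (#|star v| <= 3)%N.
Proof.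
move=> W0 tight.
case: (boolP [exists v in W, (#|star v| <= 3)%N]) => [/exists_inP //|].
rewrite negb_exists => /forallP H.
have : \sum_(v in W) 4%:Z <= \sum_(v in W) #|star v|%:Z.
  by apply: ler_sum => v vW; have := H v; rewrite vW /=; clear; lia.
have -> : \sum_(v in W) #|star v|%:Z = 2 * #|F|%:Z.
  transitivity (\sum_(v in W) \sum_e indz (e \in star v)).
    by apply: eq_bigr => v _; apply: card_sum_indz.
  rewrite exchange_big /= card_sum_indz mulr_sumr; apply: eq_bigr => e _.
  case: (boolP (e \in F)) => eF; last first.
    by rewrite big1 // => v _; rewrite inE (negPf eF).
  have [g1 g2] := FW eF.
  transitivity (\sum_(v in W) (indz ((g e).1 == v) + indz ((g e).2 == v))).
    apply: eq_bigr => v _; rewrite inE eF /=.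
    case: ((g e).1 =P v) => [<-|_] /=; last by case: (_ == v).
    by rewrite eq_sym (negPf (sparse_loopless eF)).
  by rewrite big_split /= !sum_in_indz g1 g2.
rewrite -innz_full tight sumr_const -mulr_natr; move: W0; clear; lia.
Qed.

End Degree.

Lemma star_notin (V E : finType) (g : E -> V * V) (F : {set E}) v e :
  e \in F -> e \notin star g F v -> (g e).1 != v /\ (g e).2 != v.
Proof. by move=> eF; rewrite inE eF /= negb_or => /andP[]. Qed.

Lemma joins_inW (V E : finType) (g : E -> V * V) v a e (X : {set V}) : joins g e v a -> v \notin X ->
  [&& (g e).1 \in X & (g e).2 \in X] = false.
Proof. by move=> [_ [] ->] vX /=; rewrite (negPf vX) ?andbF. Qed.

(* The Henneberg move: v has degree three; splitting off e1 and e2 at v gives a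
   sparse tight set on W :\ v. *)
Lemma henneberg (V E : finType) (g : E -> V * V) (F : {set E}) (W : {set V}) v e1 e2 e3 a b c :
  v \in W ->
  (forall e, e \in F -> (g e).1 \in W /\ (g e).2 \in W) ->
  sparse g F W -> innz g F W = 2 * #|W|%:Z - 2 ->
  star g F v = [set e1; e2; e3] -> e1 != e2 -> e1 != e3 -> e2 != e3 ->
  joins g e1 v a -> joins g e2 v b -> joins g e3 v c -> a \in W -> b \in W -> c \in W ->
  (forall X : {set V}, X \subset W :\ v -> a \in X -> b \in X ->
     innz g F X <= 2 * #|X|%:Z - 3) ->
  (forall (g' : E -> V * V) (F' : {set E}), (forall e, e \in F' -> (g' e).1 \in W :\ v /\ (g' e).2 \in W :\ v) ->
     sparse g' F' (W :\ v) -> innz g' F' (W :\ v) = 2 * #|W :\ v|%:Z - 2 ->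
     exists A B : {set E}, [/\ A \subset F', B \subset F', [disjoint A & B],
        connects g' A (W :\ v) & connects g' B (W :\ v)]) ->
  exists A B : {set E}, [/\ A \subset F, B \subset F, [disjoint A & B],
     connects g A W & connects g B W].
Proof.
move=> vW FW sp tight st n12 n13 n23 J1 J2 J3 aW bW cW low IH.
have inst e : e \in F -> (e == e1) || (e == e2) || (e == e3) = false ->
    (g e).1 != v /\ (g e).2 != v.
  by move=> eF ne; apply: (star_notin eF); rewrite st !inE ne.
have [sF1 sF2 sF3] : [/\ e1 \in F, e2 \in F & e3 \in F].
  have s e : e \in star g F v -> e \in F by rewrite inE => /andP[].
  by split; apply: s; rewrite st !inE eqxx ?orbT.
have [va _] := J1; have [vb _] := J2.
(* The name [e1] is reused for the new edge [ab], which stands for the path along [e1] and [e2]. *)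
pose g' := set_end g e1 (a, b); pose F' := F :\ e2 :\ e3.
have g'e e : e != e1 -> g' e = g e by rewrite /g' /set_end => /negPf ->.
have g'1 : g' e1 = (a, b) by rewrite /g' /set_end eqxx.
have F'W e : e \in F' -> (g' e).1 \in W :\ v /\ (g' e).2 \in W :\ v.
  rewrite !inE => /and3P[ne3 ne2 eF]; have [->|ne1] := eqVneq e e1.
    by rewrite g'1 /= aW bW !andbT !(eq_sym _ v).
  rewrite (g'e _ ne1); have [-> ->] := FW e eF; rewrite !andbT.
  by apply: inst => //; rewrite (negPf ne1) (negPf ne2) (negPf ne3).
have innE (X : {set V}) : v \notin X ->
    innz g' F' X = innz g F X + indz ((a \in X) && (b \in X)).
  move=> vX; rewrite /innz (bigD1 e1) //= [in RHS](bigD1 e1) //=.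
  rewrite g'1 (joins_inW J1 vX) andbF indzF add0r addrC !inE n13 n12 sF1 /=; congr (_ + _).
  apply: eq_bigr => e ne1; rewrite (g'e _ ne1) !inE.
  have [->|ne3] := eqVneq e e3; first by rewrite (joins_inW J3 vX) !andbF.
  have [->|ne2] := eqVneq e e2; first by rewrite (joins_inW J2 vX) !andbF.
  by [].
have cardW : #|W|%:Z = #|W :\ v|%:Z + 1 by rewrite (cardsD1 v W) vW; clear; lia.
have stc : #|star g F v| = 3%N by rewrite st setUC cardsU1 cards2 !inE negb_or n12 !(eq_sym e3) n13 n23.
have [|||A' [B' [AF BF AB cA cB]]] := IH g' F'.
- exact: F'W.
- apply/forallP => X; apply/implyP => /andP[XW X0].
  have vX : v \notin X by apply/negP => /(subsetP XW); rewrite !inE eqxx.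
  rewrite innE //; have := sparseP sp (subset_trans XW (subD1set _ _)) X0.
  have := low X XW; case: (a \in X); case: (b \in X) => /= lowX; rewrite ?indzT ?indzF;
    [have := lowX isT isT| | |]; clear; lia.
- have vX : v \notin W :\ v by rewrite !inE eqxx.
  rewrite innE // !inE aW bW !(eq_sym _ v) va vb /= indzT.
  by have := star_card FW v; rewrite stc tight cardW; clear; lia.
have sub (X : {set E}) : X \subset F' -> X \subset F.
  by move=> /subset_trans; apply; rewrite /F' !subDset; apply: subset_trans (subsetUr _ _); apply: subsetUr.
have nF' e (X : {set E}) : X \subset F' -> (e == e2) || (e == e3) -> e \notin X.
  by move=> /subsetP XF h; apply/negP => /XF; rewrite !inE => /and3P[h3 h2 _];
    rewrite (negPf h2) (negPf h3) in h.
(* The set containing e1 receives e2 and the other one e3. *)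
have go (P Q : {set E}) : P \subset F' -> Q \subset F' -> [disjoint P & Q] -> e1 \notin Q ->
    connects g' P (W :\ v) -> connects g' Q (W :\ v) ->
    [/\ e1 |: (e2 |: P) \subset F, e3 |: Q \subset F,
      [disjoint e1 |: (e2 |: P) & e3 |: Q], connects g (e1 |: (e2 |: P)) W &
      connects g (e3 |: Q) W].
  move=> PF QF PQ e1Q cP cQ; split.
  - by rewrite !subUset !sub1set sF1 sF2 (sub _ PF).
  - by rewrite !subUset !sub1set sF3 (sub _ QF).
  - rewrite -setI_eq0; apply/eqP/setP => e; rewrite !inE; apply/negbTE/negP.
    case/andP=> /or3P[/eqP ->|/eqP ->|eP] /orP[|].
    + by rewrite (negPf n13).
    + by rewrite (negPf e1Q).
    + by rewrite (negPf n23).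
    + by apply/negP; apply: nF' QF _; rewrite eqxx.
    + by move=> /eqP ee; rewrite ee (negPf (nF' e3 _ PF _)) ?eqxx ?orbT in eP.
    + by move=> eQ; rewrite (disjointFr PQ eP) in eQ.
  - apply: (connects_add vW cP J1 _ aW); first by rewrite !inE eqxx.
    move=> X _ e' e'P; have [->|ne1] := eqVneq e' e1.
      rewrite g'1 !inE /= !(eq_sym _ v) va vb /= => abX.
      have [_ G1] := J1; have [_ G2] := J2.
      have [vaX|vaX] := boolP ((v \in X) == (a \in X)).
        exists e2; first by rewrite !inE eqxx orbT.
        by move: abX; rewrite -(eqP vaX); case: G2 => -> //=; rewrite eq_sym.
      exists e1; first by rewrite !inE eqxx.
      by case: G1 => -> //=; rewrite eq_sym.
    rewrite (g'e _ ne1) => cr; exists e'; first by rewrite !inE e'P !orbT.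
    have [] := F'W e' (subsetP PF _ e'P); rewrite (g'e _ ne1) !inE => /andP[v1 _] /andP[v2 _].
    by move: cr; rewrite !inE v1 v2.
  - apply: (connects_add vW cQ J3 _ cW); first by rewrite !inE eqxx.
    move=> X _ e' e'Q; have ne1 : e' != e1 by apply: contraNneq e1Q => <-.
    rewrite (g'e _ ne1) => cr; exists e'; first by rewrite !inE e'Q !orbT.
    have [] := F'W e' (subsetP QF _ e'Q); rewrite (g'e _ ne1) !inE => /andP[v1 _] /andP[v2 _].
    by move: cr; rewrite !inE v1 v2.
have [e1B|e1B] := boolP (e1 \in B').
  have e1A : e1 \notin A' by rewrite (disjointFl AB e1B).
  rewrite disjoint_sym in AB.
  by exists (e1 |: (e2 |: B')), (e3 |: A'); apply: go.
by exists (e1 |: (e2 |: A')), (e3 |: B'); apply: go.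
Qed.

(** Some vertex has degree 2 or 3. In the first case each of the two subgraphs takes one of its
    edges; in the second a Henneberg move is possible for one of two pairs of its edges. *)
Lemma sparse_two_connects (V E : finType) (g : E -> V * V) (F : {set E}) (W : {set V}) :
  W != set0 ->
  (forall e, e \in F -> (g e).1 \in W /\ (g e).2 \in W) ->
  sparse g F W -> innz g F W = 2 * #|W|%:Z - 2 ->
  exists A B : {set E}, [/\ A \subset F, B \subset F, [disjoint A & B],
     connects g A W & connects g B W].
Proof.
have [n] := ubnP #|W|; elim: n => // n IH in g F W *; rewrite ltnS => Wn W0 FW sp tight.
have Wpos : (0 < #|W|)%N by rewrite card_gt0.
have [W1|W1] := leqP #|W| 1.
  have con (A : {set E}) : connects g A W.
    move=> X XW X0 XnW; have := proper_card (_ : X \proper W).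
    by rewrite properEneq XnW XW -card_gt0 in X0 * => /(_ isT); move: X0 W1; clear; lia.
  by exists set0, set0; split; rewrite ?sub0set // -setI_eq0 setI0.
have [v vW v3] := small_star FW sp Wpos tight.
have Wv0 : W :\ v != set0.
  by rewrite -card_gt0; move: (cardsD1 v W) W1; rewrite vW; clear; lia.
have cardW : #|W|%:Z = #|W :\ v|%:Z + 1 by rewrite (cardsD1 v W) vW; clear; lia.
have v2 : (2 <= #|star g F v|)%N.
  have := star_card FW v; rewrite tight cardW.
  by have := sparseP sp (subD1set W v) Wv0; clear; lia.
have IHv (g' : E -> V * V) (F' : {set E}) :
    (forall e, e \in F' -> (g' e).1 \in W :\ v /\ (g' e).2 \in W :\ v) ->
     sparse g' F' (W :\ v) -> innz g' F' (W :\ v) = 2 * #|W :\ v|%:Z - 2 ->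
     exists A B : {set E}, [/\ A \subset F', B \subset F', [disjoint A & B],
        connects g' A (W :\ v) & connects g' B (W :\ v)].
  by apply: IH => //; move: Wn; rewrite (cardsD1 v W) vW.
have sF e : e \in star g F v -> e \in F by rewrite inE => /andP[].
have [D2|D3] : #|star g F v| = 2%N \/ #|star g F v| = 3%N by move: v2 v3; clear; lia.
  have /cards2P[e1 [e2 [n12 st]]] : #|star g F v| == 2%N by apply/eqP.
  have s1 : e1 \in star g F v by rewrite st !inE eqxx.
  have s2 : e2 \in star g F v by rewrite st !inE eqxx orbT.
  have [a J1 [aW av]] := star_joins FW sp s1; have [b J2 [bW bv]] := star_joins FW sp s2.
  pose F' := F :\ e1 :\ e2.
  have F'W e : e \in F' -> (g e).1 \in W :\ v /\ (g e).2 \in W :\ v.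
    rewrite !inE => /and3P[ne2 ne1 eF]; have [-> ->] := FW e eF; rewrite !andbT.
    by apply: (star_notin eF); rewrite st !inE (negPf ne1) (negPf ne2).
  have innE (X : {set V}) : v \notin X -> innz g F' X = innz g F X.
    move=> vX; apply: eq_bigr => e _; rewrite !inE.
    have [->|ne2] := eqVneq e e2; first by rewrite (joins_inW J2 vX) !andbF.
    by have [->|ne1] := eqVneq e e1; first by rewrite (joins_inW J1 vX) !andbF.
  have [|||A' [B' [AF BF AB cA cB]]] := IHv g F'.
  - exact: F'W.
  - apply/forallP => X; apply/implyP => /andP[XW X0].
    have vX : v \notin X by apply/negP => /(subsetP XW); rewrite !inE eqxx.
    by rewrite innE //; apply: (sparseP sp) X0; apply: subset_trans XW (subD1set _ _).
  - have vX : v \notin W :\ v by rewrite !inE eqxx.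
    by rewrite innE //; have := star_card FW v; rewrite D2 tight cardW; clear; lia.
  have sub (X : {set E}) : X \subset F' -> X \subset F.
    by move=> /subset_trans; apply; rewrite /F' !subDset; apply: subset_trans (subsetUr _ _); apply: subsetUr.
  have con (P : {set E}) e c : P \subset F' -> connects g P (W :\ v) -> joins g e v c ->
      c \in W -> connects g (e |: P) W.
    move=> PF cP J cW; apply: (connects_add vW cP J _ cW); first by rewrite !inE eqxx.
    move=> X _ e' e'P cr; exists e'; first by rewrite !inE e'P orbT.
    have [] := F'W e' (subsetP PF _ e'P); rewrite !inE => /andP[u1 _] /andP[u2 _].
    by move: cr; rewrite !inE u1 u2.
  exists (e1 |: A'), (e2 |: B'); split.
  - by rewrite subUset sub1set sF ?sub.
  - by rewrite subUset sub1set sF ?sub.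
  - rewrite -setI_eq0; apply/eqP/setP => e; rewrite !inE; apply/negbTE/negP.
    case/andP=> /orP[/eqP ->|eA] /orP[|].
    + by rewrite (negPf n12).
    + by move=> /(subsetP BF); rewrite !inE eqxx andbF.
    + by move=> /eqP ee; move: (subsetP AF _ eA); rewrite ee !inE eqxx.
    + by move=> eB; rewrite (disjointFr AB eA) in eB.
  - exact: con AF cA J1 aW.
  - exact: con BF cB J2 bW.
have [e1 s1] : exists e1, e1 \in star g F v by apply/set0Pn; rewrite -card_gt0 D3.
have /cards2P[e2 [e3 [n23 st']]] : #|star g F v :\ e1| == 2%N.
  by move: (cardsD1 e1 (star g F v)); rewrite s1 D3; clear; lia.
have st : star g F v = [set e1; e2; e3] by rewrite -(setD1K s1) st' setUA.
have [n12 n13] : e1 != e2 /\ e1 != e3.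
  have h e : e \in star g F v :\ e1 -> e1 != e by rewrite !inE eq_sym => /andP[].
  by split; apply: h; rewrite st' !inE eqxx ?orbT.
have s2 : e2 \in star g F v by rewrite st !inE eqxx orbT.
have s3 : e3 \in star g F v by rewrite st !inE eqxx orbT.
have [a J1 [aW av]] := star_joins FW sp s1; have [b J2 [bW bv]] := star_joins FW sp s2.
have [c J3 [cW cv]] := star_joins FW sp s3.
pose blocked x y := [exists X : {set V}, [&& X \subset W :\ v, x \in X, y \in X &
   innz g F X == 2 * #|X|%:Z - 2]].
have low x y : ~~ blocked x y -> forall X : {set V}, X \subset W :\ v -> x \in X -> y \in X ->
     innz g F X <= 2 * #|X|%:Z - 3.
  rewrite negb_exists => /forallP H X XW xX yX; have := H X; rewrite XW xX yX /=.
  have X0 : X != set0 by apply/set0Pn; exists x.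
  by have := sparseP sp (subset_trans XW (subD1set _ _)) X0; clear; lia.
case: (boolP (blocked a b)) => [/existsP[X /and4P[XW aX bX /eqP tX]]|nab]; last first.
  exact: (henneberg vW FW sp tight st n12 n13 n23 J1 J2 J3 aW bW cW (low _ _ nab) IHv).
case: (boolP (blocked b c)) => [/existsP[Y /and4P[YW bY cY /eqP tY]]|nbc]; last first.
  have st2 : star g F v = [set e2; e3; e1].
    by apply/setP => e; rewrite st !inE -orbA orbC.
  apply: (henneberg vW FW sp tight st2 n23 _ _ J2 J3 J1 bW cW aW (low _ _ nbc) IHv);
    by rewrite eq_sym.
have XW' := subset_trans XW (subD1set _ _); have YW' := subset_trans YW (subD1set _ _).
(* If both pairs are blocked, a tight set [U] contains all three neighbours of [v]. Adding [v]
   brings three more edges, while sparsity allows only two. *)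
have tU := tightU sp XW' YW' bX bY tX tY.
set U := X :|: Y in tU.
have vU : v \notin U.
  by apply/negP; rewrite inE => /orP[/(subsetP XW)|/(subsetP YW)]; rewrite !inE eqxx.
have vUW : v |: U \subset W by rewrite subUset sub1set vW subUset XW' YW'.
have vU0 : v |: U != set0 by apply/set0Pn; exists v; rewrite !inE eqxx.
have := sparseP sp vUW vU0; rewrite cardsU1 vU.
suff : innz g F U + 3 <= innz g F (v |: U) by rewrite tU; clear; lia.
have -> : 3 = #|star g F v|%:Z by rewrite D3.
rewrite card_sum_indz /innz -big_split /=; apply: ler_sum => e _.
have endU e' z : joins g e' v z -> z \in U -> [&& (g e').1 \in v |: U & (g e').2 \in v |: U].
  by move=> [_ [] ->] zU /=; rewrite !inE eqxx /= -in_setU zU ?orbT.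
case: (boolP (e \in star g F v)) => es.
  have eF := sF _ es.
  have [] : [&& (g e).1 \in v |: U & (g e).2 \in v |: U] /\
      [&& (g e).1 \in U & (g e).2 \in U] = false.
    move: es; rewrite st => /setUP[/setUP[]|] /set1P ->.
    - by split; [apply: (endU _ a) => //; rewrite inE aX|apply: joins_inW J1 vU].
    - by split; [apply: (endU _ b) => //; rewrite inE bX|apply: joins_inW J2 vU].
    - by split; [apply: (endU _ c) => //; rewrite inE cY orbT|apply: joins_inW J3 vU].
  by move=> -> ->; rewrite eF /= indzT indzF.
rewrite indzF addr0; case: (e \in F) => //=.
have sU z : z \in U -> z \in v |: U by move=> zU; rewrite in_setU zU orbT.
by case: (boolP ((g e).1 \in U)) => // /sU ->; case: (boolP ((g e).2 \in U)) => // /sU ->.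
Qed.

(* Nash-Williams and Tutte, for two trees. A maximum sparse edge set contains
   every edge between distinct maximal tight sets. *)
Lemma two_connects (V E : finType) (g : E -> V * V) (v0 : V) :
  (forall X : {set V}, X != set0 -> X != setT -> 4 <= cutz g X) ->
  exists A B : {set E}, [/\ [disjoint A & B], connects g A setT & connects g B setT].
Proof.
move=> cut4.
have sp0 : sparse g set0 setT.
  apply/forallP => X; apply/implyP => /andP[_]; rewrite -card_gt0 => X0.
  by rewrite /innz big1 => [|e _]; [move: X0; clear; lia|rewrite inE].
case: (@arg_maxnP _ set0 (fun F => sparse g F setT) (fun F : {set E} => #|F|) sp0) => F sp Fmax.
pose tight (X : {set V}) := innz g F X == 2 * #|X|%:Z - 2.
have tight1 v : (v \in [set v]) && tight [set v].
  rewrite inE eqxx /tight cards1 /=.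
  have n0 : [set v] != set0 by apply/set0Pn; exists v; rewrite inE.
  by have := sparseP sp (subsetT _) n0; have := innz_ge0 g F [set v]; rewrite cards1; clear; lia.
(* Singletons are tight and intersecting tight sets have a tight union, so the sets [C v] partition
   the vertices. *)
pose C v := [arg max_(X > [set v] | (v \in X) && tight X) #|X|].
have CP v : [/\ v \in C v, tight (C v) & forall X : {set V}, v \in X -> tight X -> (#|X| <= #|C v|)%N].
  rewrite /C; case: (@arg_maxnP _ [set v] (fun X : {set V} => (v \in X) && tight X)
    (fun X : {set V} => #|X|) (tight1 v)) => X /andP[vX tX] Xm.
  by split=> // Y vY tY; apply: Xm; rewrite vY.
have tU (X Y : {set V}) z : z \in X -> z \in Y -> tight X -> tight Y -> tight (X :|: Y).
  move=> zX zY /eqP tX /eqP tY; apply/eqP.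
  exact: (tightU sp (subsetT _) (subsetT _) zX zY tX tY).
have subC (X : {set V}) v : v \in X -> tight X -> X \subset C v.
  move=> vX tX; have [vC tC Cm] := CP v.
  have UE : C v = X :|: C v.
    apply/eqP; rewrite eqEcard subsetUr; apply: Cm; first by rewrite inE vX.
    exact: (tU _ _ v).
  by rewrite UE subsetUl.
have CE u v : u \in C v -> C u = C v.
  move=> uC; have [vC tC _] := CP v; have [uCu tCu _] := CP u.
  have s1 := subC _ _ uC tC; apply/eqP; rewrite eqEsubset s1 andbT.
  by apply: subC => //; apply: (subsetP s1).
(* As [F] is maximum, adding [e] violates sparsity at some set, which is then tight and contains
   both ends of [e]. *)
have edgeC e : e \notin F -> C (g e).1 = C (g e).2.
  move=> eF; have : ~~ sparse g (e |: F) setT.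
    by apply/negP => /Fmax; rewrite cardsU1 eF; clear; lia.
  rewrite negb_forall => /existsP[X]; rewrite negb_imply subsetT /= => /andP[X0 nX].
  have inE1 : innz g (e |: F) X = innz g F X + indz (((g e).1 \in X) && ((g e).2 \in X)).
    rewrite /innz (bigD1 e) //= [in RHS](bigD1 e) //= setU11 (negPf eF) /= indzF add0r addrC.
    congr (_ + _); apply: eq_bigr => e' ne; by rewrite !inE (negPf ne).
  have := sparseP sp (subsetT X) X0; move: nX; rewrite inE1 => nX leX.
  have [e1 e2 tX] : [/\ (g e).1 \in X, (g e).2 \in X & tight X].
    move: nX leX; rewrite /tight; case: ((g e).1 \in X); case: ((g e).2 \in X) => /=;
      rewrite ?indzT ?indzF => h1 h2; split => //; move: h1 h2; clear; lia.
  by apply: CE; apply: (subsetP (subC _ _ e2 tX)).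
pose P := [set C v | v : V].
have memP (B : {set V}) x : B \in P -> (x \in B) = (C x == B).
  case/imsetP=> v _ ->; apply/idP/eqP => [/CE //|<-]; by have [] := CP x.
have sumP1 x : \sum_(B in P) indz (x \in B) = 1.
  transitivity (\sum_(B in P) indz (C x == B)).
    by apply: eq_bigr => B /memP ->.
  by rewrite sum_in_indz imset_f.
have sumP2 x y : \sum_(B in P) indz ((x \in B) && (y \in B)) = indz (C x == C y).
  have [Cxy|Cxy] := eqVneq (C x) (C y).
    rewrite indzT -(sumP1 x); apply: eq_bigr => B BP; rewrite !(memP _ _ BP) Cxy.
    by rewrite andbb.
  rewrite indzF big1 // => B BP; rewrite !(memP _ _ BP).
  by case: eqP => // <-; rewrite eq_sym (negPf Cxy).
have sumV : \sum_(B in P) #|B|%:Z = #|V|%:Z.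
  transitivity (\sum_(B in P) \sum_x indz (x \in B)).
    by apply: eq_bigr => B _; apply: card_sum_indz.
  rewrite exchange_big /= -cardsT card_sum_indz; apply: eq_bigr => x _.
  by rewrite sumP1 inE.
have sumF : \sum_(B in P) innz g F B = \sum_e indz ((e \in F) && (C (g e).1 == C (g e).2)).
  rewrite /innz exchange_big /=; apply: eq_bigr => e _.
  by case: (e \in F) => /=; [apply: sumP2|rewrite big1].
have sumcut : \sum_(B in P) cutz g B = 2 * \sum_e indz (C (g e).1 != C (g e).2).
  rewrite /cutz exchange_big /= mulr_sumr; apply: eq_bigr => e _.
  transitivity (\sum_(B in P) (indz ((g e).1 \in B) + indz ((g e).2 \in B)
      - 2 * indz (((g e).1 \in B) && ((g e).2 \in B)))).
    by apply: eq_bigr => B _; rewrite /crosses; case: (_ \in B); case: (_ \in B).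
  by rewrite sumrB big_split /= -mulr_sumr !sumP1 sumP2; case: (_ == _).
have Fsum : innz g F setT = \sum_(B in P) innz g F B + \sum_e indz (C (g e).1 != C (g e).2).
  rewrite sumF -big_split /=; apply: eq_bigr => e _; rewrite !inE andbT /=.
  case: (boolP (e \in F)) => eF /=; first by case: (_ == _).
  by rewrite (edgeC _ eF) eqxx.
(* With [p > 1] classes, the cuts of size at least 4 give [2 * p] edges between classes. Together
   with those inside they number at least [2 * #|V|], against sparsity. *)
have Ft : innz g F setT = 2 * #|[set: V]|%:Z - 2.
  have [CT|CT] := eqVneq (C v0) setT; first by have [_ /eqP] := CP v0; rewrite CT.
  have T0 : [set: V] != set0 by apply/set0Pn; exists v0; rewrite inE.
  have := sparseP sp (subsetT setT) T0.
  have : \sum_(B in P) 4%:Z <= \sum_(B in P) cutz g B.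
    apply: ler_sum => B /imsetP[v _ ->]; have [vC _ _] := CP v; apply: cut4.
      by apply/set0Pn; exists v.
    apply: contraNneq CT => CvT; apply/eqP; rewrite -CvT; apply: CE.
    by rewrite CvT inE.
  have : \sum_(B in P) innz g F B = \sum_(B in P) (2 * #|B|%:Z - 2).
    by apply: eq_bigr => B /imsetP[v _ ->]; have [_ /eqP ->] := CP v.
  rewrite sumrB -mulr_sumr sumV !sumr_const -[2 *+ #|P|]mulr_natr -[4 *+ #|P|]mulr_natr cardsT => s1 s2 s3.
  by move: s1 s2 s3; rewrite sumcut Fsum; clear; lia.
have [||A [B [_ _ AB cA cB]]] := sparse_two_connects _ _ sp Ft.
- by apply/set0Pn; exists v0; rewrite inE.
- by move=> e _; rewrite !inE.
by exists A, B.
Qed.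

(** * Signs of the negative edges *)

Definition oddat (V E : finType) (g : E -> V * V) (J : {set E}) (v : V) : bool :=
  \big[addb/false]_e ((e \in J) && (((g e).1 == v) (+) ((g e).2 == v))).

Lemma xor_pick (T : finType) (x : T) (c : T -> bool) :
  \big[addb/false]_y ((y == x) && c y) = c x.
Proof.
rewrite (bigD1 x) //= eqxx /= big1 ?addbF // => y /negPf -> //.
Qed.

Lemma xor_in (T : finType) (X : {set T}) (x : T) :
  \big[addb/false]_(y in X) (x == y) = (x \in X).
Proof.
rewrite big_mkcond /= -(xor_pick x (fun y => y \in X)).
by apply: eq_bigr => y _; rewrite eq_sym; case: (y \in X); rewrite ?andbT ?andbF.
Qed.

Definition toggle (E : finType) (J : {set E}) (e : E) := [set e' | (e' \in J) (+) (e' == e)].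

Lemma oddat_toggle (V E : finType) (g : E -> V * V) (J : {set E}) e v :
  oddat g (toggle J e) v = oddat g J v (+) ((g e).1 == v) (+) ((g e).2 == v).
Proof.
rewrite -addbA -(xor_pick e (fun e => ((g e).1 == v) (+) ((g e).2 == v))) -big_split /=.
by apply: eq_bigr => e' _; rewrite inE andb_addl.
Qed.

Lemma xor_oddat (V E : finType) (g : E -> V * V) (J : {set E}) (X : {set V}) :
  \big[addb/false]_(v in X) oddat g J v
   = \big[addb/false]_e ((e \in J) && (((g e).1 \in X) (+) ((g e).2 \in X))).
Proof.
rewrite exchange_big /=; apply: eq_bigr => e _.
case: (e \in J) => /=; last by rewrite big1.
by rewrite big_split /= !xor_in.
Qed.

(** Existence of a T-join. Toggling edges along a walk from a bad vertex [u] moves the defect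
    anywhere, since [R] is closed under the edges of [A]; moved to another bad vertex, which exists
    by parity, it cancels. *)
Lemma join_exists (V E : finType) (g : E -> V * V) (A : {set E}) (t : V -> bool) :
  connects g A setT -> \big[addb/false]_v t v = false ->
  exists2 J : {set E}, J \subset A & forall v, oddat g J v = t v.
Proof.
move=> con tE; pose bad (J : {set E}) := [set v | oddat g J v (+) t v].
case: (@arg_minnP _ set0 (fun J : {set E} => J \subset A) (fun J => #|bad J|) (sub0set A)) => J JA Jmin.
have [b0|/set0Pn[u ub]] := eqVneq (bad J) set0.
  exists J => // v; move/setP/(_ v): b0; rewrite !inE.
  by case: (oddat g J v); case: (t v).
pose good w (J' : {set E}) := (J' \subset A) && [forall v, oddat g J' v == oddat g J v (+) (v == u) (+) (v == w)].
pose R := [set w | [exists J' : {set E}, good w J']].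
have uR : u \in R.
  rewrite inE; apply/existsP; exists J; rewrite /good JA; apply/forallP => v.
  by rewrite -addbA addbb addbF.
have RT : R = setT.
  apply/eqP; apply/negPn/negP => RnT.
  have [|e eA cr] := con R (subsetT _) _ RnT; first by apply/set0Pn; exists u.
  have step p q : ((g e).1 = p /\ (g e).2 = q) \/ ((g e).1 = q /\ (g e).2 = p) -> p \in R -> q \in R.
    rewrite !inE => pq /existsP[J' /andP[J'A /forallP J'E]]; apply/existsP.
    exists (toggle J' e); apply/andP; split.
      apply/subsetP => e'; rewrite inE; have [->|ne] := eqVneq e' e; first by rewrite eA.
      by rewrite addbF; apply: (subsetP J'A).
    apply/forallP => v; rewrite oddat_toggle (eqP (J'E v)) !(eq_sym v).
    by case: pq => -[-> ->]; case: (oddat g J v); case: (u == v); case: (p == v); case: (q == v).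
  move: cr; case e1 : ((g e).1 \in R); case e2 : ((g e).2 \in R) => // _.
    by rewrite (step (g e).1 (g e).2) // in e2; left.
  by rewrite (step (g e).2 (g e).1) // in e1; right.
have badE (J' : {set E}) v : (v \in bad J') = oddat g J' v (+) t v by rewrite inE.
have [w wb wu] : exists2 w, w \in bad J & w != u.
  have [bu|bu] := eqVneq (bad J) [set u]; last first.
    have : ~~ (bad J \subset [set u]).
      by apply: contra bu => bs; rewrite eqEsubset bs sub1set.
    by case/subsetPn => w wb; rewrite inE => wu; exists w.
  have : \big[addb/false]_v (v \in bad J) = false.
    transitivity (\big[addb/false]_v (oddat g J v (+) t v)).
      by apply: eq_bigr => v _; rewrite badE.
    rewrite big_split /= tE addbF -(big_mkcond xpredT).
    have := xor_oddat g J setT; rewrite (eq_bigl xpredT) => [->|v]; last by rewrite inE.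
    by rewrite big1 // => e _; rewrite !inE andbF.
  have := xor_in [set: V] u; rewrite inE (eq_bigl xpredT) => [xu|v]; last by rewrite inE.
  rewrite bu (eq_bigr (fun v => u == v)) ?xu // => v _.
  by rewrite inE eq_sym.
have : w \in R by rewrite RT.
rewrite inE => /existsP[J' /andP[J'A /forallP J'E]].
have := ub; have := wb; rewrite !badE => wb' ub'.
have : (#|bad J'| < #|bad J|)%N.
  apply: proper_card; apply/properP; split.
    apply/subsetP => v; rewrite !badE (eqP (J'E v)).
    have [->|vu] := eqVneq v u; first by rewrite ub'.
    have [->|vw] := eqVneq v w; first by rewrite wb'.
    by rewrite !addbF.
  exists u => //; rewrite badE (eqP (J'E u)) eqxx eq_sym (negPf wu) addbF.
  by move: ub; rewrite badE; case: (oddat g J u); case: (t u).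
by rewrite ltnNge Jmin.
Qed.

Lemma cutz_parity (V E : finType) (g : E -> V * V) (X : {set V}) :
  exists l : int, cutz g X = indz (\big[addb/false]_(v in X) oddat g setT v) + 2 * l.
Proof.
rewrite xor_oddat cutz_card; set n := #|_|.
have -> : \big[addb/false]_e ((e \in setT) && (((g e).1 \in X) (+) ((g e).2 \in X))) = odd n.
  rewrite /n -sum1dep_card [in RHS]big_mkcond (big_morph odd oddD (erefl : odd 0 = false)).
  apply: eq_bigr => e _; rewrite inE /=.
  by case: ((g e).1 \in X); case: ((g e).2 \in X).
exists (n./2)%:Z; have := odd_double_half n; rewrite /indz; move: (odd n) (n./2) => b q.
by clear; case: b; lia.
Qed.

Lemma sum_weight (T : finType) (phi : T -> int) u : \sum_x phi x * indz (u == x) = phi u.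
Proof.
rewrite (bigD1 u) //= eqxx mulr1 big1 ?addr0 // => x /negPf.
by rewrite eq_sym => ->; rewrite mulr0.
Qed.

Lemma net_weight (V E : finType) (h : E -> V * V) (phi : V -> int) :
  \sum_v phi v * net h v = \sum_e (phi (h e).1 - phi (h e).2).
Proof.
rewrite /net; under eq_bigr do rewrite mulr_sumr.
rewrite exchange_big /=; apply: eq_bigr => e _.
by under eq_bigr do rewrite mulrBr; rewrite sumrB !sum_weight.
Qed.

Definition pos_graph (V E : finType) (g : E -> V * V) (sigma : E -> bool) : E -> V * V :=
  fun e => if sigma e then ((g e).1, (g e).1) else g e.

(* Each negative edge becomes an edge between two copies of V; joins J1 and J2,
   one in each copy, make the resulting graph Eulerian (up to a demand at the
   copies of v0 when the number of negative edges is odd), and an Eulerian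
   orientation yields the signs. *)
Lemma balanced_signs (V E : finType) (g : E -> V * V) (sigma : E -> bool) (v0 : V)
    (A B : {set E}) :
  let gP := pos_graph g sigma in
  let c := odd #|[set e | sigma e]| in
  [disjoint A & B] -> connects gP A setT -> connects gP B setT ->
  exists s : E -> int, (forall e, s e = 1 \/ s e = -1) /\
    forall X : {set V},
     `| \sum_(e | sigma e) s e * (indz ((g e).1 \in X) + indz ((g e).2 \in X))
        + 2 * indz (c && (v0 \in X)) | <= cutz gP X.
Proof.
move=> gP c AB cA cB.
have xorN : \big[addb/false]_e sigma e = c.
  rewrite /c -sum1dep_card [in RHS]big_mkcond (big_morph odd oddD (erefl : odd 0 = false)).
  by apply: eq_bigr => e _; case: (sigma e).
(* The term at [v0] makes the total parity even, as a join requires. *)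
pose tok (f : E -> V) v := (c && (v == v0)) (+) \big[addb/false]_e (sigma e && (f e == v)).
have tokE f : \big[addb/false]_v tok f v = false.
  rewrite big_split /= exchange_big /=.
  have -> : \big[addb/false]_v (c && (v == v0)) = c.
    rewrite (eq_bigr (fun v => (v == v0) && c)) => [|v _]; last by rewrite andbC.
    exact: (xor_pick v0 (fun=> c)).
  rewrite [X in _ (+) X](eq_bigr sigma) => [|e _]; first by rewrite xorN addbb.
  rewrite (eq_bigr (fun v => (v == f e) && sigma e)) => [|v _].
    exact: (xor_pick (f e) (fun=> sigma e)).
  by rewrite andbC eq_sym.
have [J1 J1A J1E] := join_exists cA (tokE (fun e => (g e).1)).
have [J2 J2B J2E] := join_exists cB (tokE (fun e => (g e).2)).
have J12 e : e \in J2 -> e \in J1 = false.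
  move=> e2; apply/negbTE/negP => e1.
  by have := disjointFr AB (subsetP J1A _ e1); rewrite (subsetP J2B _ e2).
pose G e : (V * bool) * (V * bool) :=
  if sigma e then (((g e).1, true), ((g e).2, false))
  else if e \in J1 then (((g e).1, true), ((g e).2, true))
  else if e \in J2 then (((g e).1, false), ((g e).2, false))
  else ((v0, true), (v0, true)).
have GE x : oddat G setT x = c && (x.1 == v0).
  case: x => v [] /=.
    transitivity (oddat gP J1 v (+) \big[addb/false]_e (sigma e && ((g e).1 == v))).
      rewrite -big_split /=; apply: eq_bigr => e _; rewrite inE /G /gP /pos_graph.
      case: (sigma e) => /=; first by rewrite !xpair_eqE /= andbF andbT addbF addbb andbF.
      case: (e \in J1) => /=; first by rewrite !xpair_eqE /= !andbT addbF.
      case: (e \in J2) => /=; first by rewrite !xpair_eqE /= !andbF.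
      by rewrite addbb.
    by rewrite J1E /tok -addbA addbb addbF.
  transitivity (oddat gP J2 v (+) \big[addb/false]_e (sigma e && ((g e).2 == v))).
    rewrite -big_split /=; apply: eq_bigr => e _; rewrite inE /G /gP /pos_graph.
    case: (sigma e) => /=; first by rewrite !xpair_eqE /= andbF andbT addbb andbF.
    case e2 : (e \in J2) => /=; first by rewrite (J12 e e2) !xpair_eqE /= !andbT addbF.
    by case: (e \in J1) => /=; rewrite !xpair_eqE /= !andbF.
  by rewrite J2E /tok -addbA addbb addbF.
pose t := bump (v0, true) (- indz c) (bump (v0, false) (indz c) (fun=> 0)).
have tX (X : {set V * bool}) : sumon t X = indz ((v0, false) \in X) * indz c - indz ((v0, true) \in X) * indz c.
  by rewrite !sumon_bump [sumon (fun=> 0) X]big1 // add0r mulrN.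
have par (X : {set V * bool}) : exists l : int, cutz G X = sumon t X + 2 * l.
  have [l ->] := cutz_parity G X.
  have -> : \big[addb/false]_(v in X) oddat G setT v
     = c && (((v0, true) \in X) (+) ((v0, false) \in X)).
    rewrite (eq_bigr (fun x => c && (((v0, true) == x) (+) ((v0, false) == x)))).
      by case: (c) => /=; [rewrite big_split /= !xor_in|rewrite big1].
    move=> [v b] _; rewrite GE !xpair_eqE /= (eq_sym v).
    by case: (c); case: (v0 == v); case: b.
  rewrite tX; clear; case: (c); case: ((v0, true) \in X); case: ((v0, false) \in X);
    rewrite /= ?indzT ?indzF; first [by exists l; lia|by exists (l + 1); lia].
have [|X|X|h [Gh hn]] := @orientation_with_net _ _ G t.
- by rewrite tX !inE subrr.
- have := cutz_ge0 G X; have [l] := par X; rewrite tX.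
  by clear; case: ((v0, true) \in X); case: ((v0, false) \in X); case: (c);
    rewrite ?indzT ?indzF; lia.
- exact: par.
pose s e : int := if h e == G e then 1 else -1.
exists s; split; first by move=> e; rewrite /s; case: eqP; [left|right].
(* Weighting the two copies of [X] by 1 and -1 makes both ends of a negative edge count with the
   sign [s e]. A positive edge lies in at most one copy and contributes at most its crossing. *)
move=> X; pose phi (x : V * bool) : int := indz (x.1 \in X) * (if x.2 then 1 else -1).
have := net_weight h phi; under eq_bigr do rewrite hn.
have -> : \sum_x phi x * t x = - (2 * indz (c && (v0 \in X))).
  transitivity (\sum_x (phi x * indz ((v0, false) == x) * indz c - phi x * indz ((v0, true) == x) * indz c)).
    by apply: eq_bigr => x _; rewrite /t /bump !(eq_sym x) add0r mulrN mulrBr !mulrA.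
  rewrite sumrB -!mulr_suml !sum_weight /phi /=.
  by case: (c); case: (v0 \in X); rewrite /= ?indzT ?indzF; lia.
have -> : \sum_e (phi (h e).1 - phi (h e).2)
   = \sum_(e | sigma e) s e * (indz ((g e).1 \in X) + indz ((g e).2 \in X))
    + \sum_(e | ~~ sigma e) (phi (h e).1 - phi (h e).2).
  rewrite (bigID sigma) /=; congr (_ + _); apply: eq_bigr => e se.
  rewrite /s; case: (h e =P G e) => [->|nG].
    by rewrite /G se /phi /=; lia.
  by have [//|->] := Gh e; rewrite /G se /phi /=; lia.
have : `|\sum_(e | ~~ sigma e) (phi (h e).1 - phi (h e).2)| <= cutz gP X.
  apply: le_trans (ler_norm_sum _ _ _) _.
  rewrite /cutz [leRHS](bigID sigma) /= [X in X + _]big1 ?add0r; last first.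
    by move=> e se; rewrite /gP /pos_graph se crosses_loop.
  apply: ler_sum => e se; rewrite /gP /pos_graph (negPf se).
  have : `|phi (G e).1 - phi (G e).2| <= crosses X (g e).
    rewrite /G (negPf se) /crosses /phi; case: (e \in J1) => /=.
      by case: (_ \in X); case: (_ \in X).
    by case: (e \in J2) => /=; [case: (_ \in X); case: (_ \in X)|rewrite subrr; case: (_ != _)].
  by have [->|->] := Gh e => //=; rewrite distrC.
set S1 := \sum_(e | sigma e) _; set S2 := \sum_(e | ~~ sigma e) _.
by clear; lia.
Qed.

(** * Integer flows *)

Lemma subset_set1 (T : finType) (X : {set T}) x : X \subset [set x] -> X = set0 \/ X = [set x].
Proof. by rewrite subset1 => /orP[] /eqP; tauto. Qed.

Lemma modular_orientation (V E : finType) (g : E -> V * V) (k : int) (t : V -> int) :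
  1 <= k ->
  (forall X : {set V}, X != set0 -> X != setT -> 6 * k <= cutz g X) ->
  (forall X : {set V}, exists l : int, cutz g X = sumon t X + 2 * l) ->
  (exists l : int, sumon t setT = 2 * (2 * k + 1) * l) ->
  exists h, reor g h /\ forall v, exists l : int, net h v = t v + 2 * (2 * k + 1) * l.
Proof.
move=> k1 cut par [ls sE]; set m := 2 * k + 1 in sE *.
have m0 : 0 < m by rewrite /m; lia.
have zV (X : {set V}) : sumon (fun=> 0) X = 0 by apply: big1.
have [V1|V1] := leqP #|[set: V]| 1.
  exists g; split=> [e|v]; first by left.
  have VE : [set: V] = [set v].
    have [] := @subset_set1 _ [set v] v (subxx _); first by move/setP/(_ v); rewrite !inE eqxx.
    by move=> _; apply/esym/eqP; rewrite eqEcard subsetT cards1.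
  have all_v u : u = v by apply/eqP; rewrite -in_set1 -VE inE.
  exists (- ls); rewrite VE sumon1 in sE; rewrite sE.
  have -> : net g v = 0.
    by apply: big1 => e _; rewrite (all_v (g e).1) (all_v (g e).2) subrr.
  lia.
have [|||h [gh hn]] := @extendable_admissible V E m setT set0 g t (fun=> 0) (fun=> 0).
- by rewrite /m; lia.
- by [].
- split.
  + by move=> e _; rewrite !inE.
  + by [].
  + by move=> x; rewrite inE.
  + by move=> x y; rewrite inE.
  + by move=> X _; rewrite /degz !zV !addr0.
  + by exists ls; rewrite !zV subr0 add0r.
  + move=> X _ X0 XT _; rewrite /degz !zV !addr0.
    (* The bound needed is at most [2 * m - 2 + m = 6 * k + 1], and a cut of size [6 * k] has the
       wrong parity for [nu = m]. *)
    have := cut X X0 XT; have := nu_le (sumon t X) m0; have [l ->] := nu_par (sumon t X) m0.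
    by have [l' ->] := par X; rewrite /m; clear; lia.
  + by rewrite /degz cutzT !zV !addr0; have := nu_ge0 (sumon t setT) m0; rewrite /m; move: k1; clear; lia.
exists h; split=> // v; have [|l lE] := hn v; first by rewrite inE.
by exists l; rewrite -lE addr0 subr0.
Qed.

Lemma sum_cut1 (V E : finType) (g : E -> V * V) (X : {set V}) :
  exists l : int, \sum_(v in X) cutz g [set v] = cutz g X + 2 * l.
Proof.
exists (\sum_e indz [&& (g e).1 != (g e).2, (g e).1 \in X & (g e).2 \in X]).
rewrite /cutz exchange_big mulr_sumr -big_split /=; apply: eq_bigr => e _.
case: (boolP ((g e).1 == (g e).2)) => [/eqP ee|ne] /=.
  rewrite /crosses ee eqxx big1 // => v _.
  by rewrite !inE eqxx.
transitivity (\sum_(v in X) (indz ((g e).1 == v) + indz ((g e).2 == v))).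
  apply: eq_bigr => v _; rewrite /crosses !inE.
  case: ((g e).1 =P v) => [<-|_]; last by case: (_ == v).
  by rewrite (eq_sym (g e).2) (negPf ne).
rewrite big_split /= !sum_in_indz /crosses.
by case: ((g e).1 \in X); case: ((g e).2 \in X).
Qed.

Definition ends_in (V E : finType) (g : E -> V * V) (X : {set V}) e : int :=
  indz ((g e).1 \in X) + indz ((g e).2 \in X).

(* Values for the negative edges, balanced on every cut of the positive graph.
   When there are an odd number of them, k of the edges with value k are raised
   to k + 1. *)
Lemma negative_values (V E : finType) (g : E -> V * V) (sigma : E -> bool) (v0 : V) (k : nat) :
  let gP := pos_graph g sigma in
  (forall X : {set V}, X != set0 -> X != setT -> 4 <= cutz gP X) ->
  ~~ odd #|[set e | sigma e]| \/ (2 * k + 1 <= #|[set e | sigma e]|)%N ->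
  exists c : E -> int, [/\ forall e, `|c e| = k%:Z \/ `|c e| = k%:Z + 1,
    \sum_(e | sigma e) c e = 0 &
    forall X : {set V}, `| \sum_(e | sigma e) c e * ends_in g X e|
      <= k%:Z * cutz gP X + 2 * k%:Z].
Proof.
move=> gP cut4 Nk.
have [A [B [AB cA cB]]] := two_connects v0 cut4.
have [s [s1 sX]] := balanced_signs v0 AB cA cB.
set b := odd #|[set e | sigma e]| in Nk sX.
have sumS : \sum_(e | sigma e) s e = - indz b.
  have := sX setT; rewrite cutzT inE andbT.
  rewrite (eq_bigr (fun e => s e * 2)) => [|e _]; last by rewrite !inE.
  by rewrite -mulr_suml; set S := \sum_(_ | _) _; clear; lia.
pose pl := [set e | sigma e && (s e == 1)].
have cardpl : #|[set e | sigma e]|%:Z = 2 * #|pl|%:Z + indz b.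
  have : \sum_(e | sigma e) s e = 2 * #|pl|%:Z - #|[set e | sigma e]|%:Z.
    rewrite !card_sum_indz mulr_sumr -sumrB big_mkcond /=; apply: eq_bigr => e _.
    by rewrite !inE; case: (sigma e) => //=; case: (s1 e) => ->.
  by rewrite sumS; clear; lia.
(* An odd number of negative edges is [2 * #|pl| + 1], and by hypothesis at least [2 * k + 1]. *)
have kpl : b -> (k <= #|pl|)%N.
  by move=> bT; move: Nk cardpl; rewrite bT /= indzT => -[//|]; clear; lia.
have [K [Kpl cardK]] : exists K : {set E}, K \subset pl /\ #|K|%:Z = indz b * k%:Z.
  case: (boolP b) => [/kpl/card_geqP[q [uq sq qpl]]|nb]; last first.
    by exists set0; rewrite sub0set cards0.
  exists [set e in q]; split; first by apply/subsetP => e; rewrite inE => /qpl.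
  by rewrite indzT mul1r -sq; congr Posz; rewrite cardsE; apply/card_uniqP.
have KE e : e \in K -> sigma e /\ s e = 1.
  by move=> /(subsetP Kpl); rewrite inE => /andP[-> /eqP].
pose c e := k%:Z * s e + indz (e \in K).
have splitc (w : E -> int) : \sum_(e | sigma e) c e * w e
   = k%:Z * \sum_(e | sigma e) s e * w e + \sum_(e in K) w e.
  rewrite mulr_sumr [\sum_(e in K) _]big_mkcond [in LHS]big_mkcond [X in X + _]big_mkcond.
  rewrite -big_split /=; apply: eq_bigr => e _; rewrite /c.
  case: (boolP (e \in K)) => [/KE[-> ->]|_]; first by rewrite indzT mulrDl mulr1 !mul1r.
  by case: (sigma e); rewrite ?indzF ?addr0 // mulrA.
exists c; split.
- move=> e; rewrite /c; case: (boolP (e \in K)) => [/KE[_ ->]|_].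
    by right; rewrite indzT; clear; lia.
  by left; rewrite indzF; case: (s1 e) => ->; clear; lia.
- have := splitc (fun=> 1); rewrite sumr_const -[1 *+ #|K|]mulr_natr mul1r.
  rewrite (eq_bigr c) => [->|e _]; last by rewrite mulr1.
  rewrite (eq_bigr s) => [|e _]; last by rewrite mulr1.
  by rewrite sumS; move: cardK; case: (b); rewrite ?indzT ?indzF; clear; lia.
- move=> X; rewrite splitc; have := sX X; rewrite -/(ends_in g X).
  set S := \sum_(e | sigma e) _; set T := \sum_(e in K) _.
  have T0 : 0 <= T by apply: sumr_ge0 => e _; rewrite addr_ge0 // indz_ge0.
  have T1 : T <= 2 * #|K|%:Z.
    have -> : 2 * #|K|%:Z = \sum_(e in K) 2%:Z.
      by rewrite sumr_const -[2 *+ #|K|]mulr_natr; clear; lia.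
    by apply: ler_sum => e _; rewrite /ends_in; case: (_ \in X); case: (_ \in X).
  move: T0 T1; rewrite cardK => T0 T1 SX.
  (* The term at [v0] and the raised values [T] both lie between 0 and [2 * k] and enter with
     opposite signs, so together they cost at most [2 * k]. *)
  have : k%:Z * `|S + 2 * indz (b && (v0 \in X))| <= k%:Z * cutz gP X.
    by rewrite ler_wpM2l.
  move: (cutz gP X) SX T0 T1 => C; clear; case: b; case: (v0 \in X); rewrite /= ?indzT ?indzF.
  + by move=> *; nia.
  + by move=> *; nia.
  + by move=> *; nia.
  + by move=> *; nia.
Qed.

(* An orientation h with net h = -2 b mod 2k+1 is corrected by a second
   orientation o with (2k+1) net o = 2 b + net h: the half-difference
   ((2k+1) o - h) / 2 is a flow with boundary b and values k and k+1. *)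
Lemma positive_values (V E : finType) (g : E -> V * V) (k : nat) (b : V -> int) :
  (0 < k)%N ->
  (forall X : {set V}, X != set0 -> X != setT -> 6 * k%:Z <= cutz g X) ->
  sumon b setT = 0 ->
  (forall X : {set V}, `|sumon b X| <= k%:Z * cutz g X + 2 * k%:Z) ->
  exists f : E -> int, (forall e, `|f e| = k%:Z \/ `|f e| = k%:Z + 1) /\
    forall v, \sum_e f e * (indz ((g e).1 == v) - indz ((g e).2 == v)) = b v.
Proof.
move=> k0 cut b0 bX; set m := 2 * k%:Z + 1.
(* The multiple of the degree gives [t] the parity of the degree, [m] being odd, and makes
   [(2 * b v + net h v) / m] an integer of that parity. *)
pose t v := - 2 * b v + m * cutz g [set v].
have tX (X : {set V}) : sumon t X = - 2 * sumon b X + m * \sum_(v in X) cutz g [set v].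
  by rewrite /sumon /t big_split /= !mulr_sumr.
have [|||h [gh hn]] := @modular_orientation V E g k t _ cut; first by lia.
- move=> X; rewrite tX; have [l ->] := sum_cut1 g X.
  by exists (sumon b X - k%:Z * cutz g X - m * l); rewrite /m; clear; lia.
- by rewrite tX b0; have [l ->] := sum_cut1 g setT; rewrite cutzT; exists l; rewrite /m; clear; lia.
have m0 : 0 < m by rewrite /m; lia.
pose u v := ((2 * b v + net h v) %/ m)%Z.
have uE v : m * u v = 2 * b v + net h v /\ exists l : int, u v = cutz g [set v] + 2 * l.
  have [l lE] := hn v; have uv : u v = cutz g [set v] + 2 * l.
    rewrite /u lE /t (_ : _ + _ = (cutz g [set v] + 2 * l) * m); last by rewrite /m; clear; lia.
    by rewrite mulzK //; move: m0; clear; lia.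
  split; last by exists l.
  by rewrite uv lE /t /m; clear; lia.
have smu (X : {set V}) : m * sumon u X = 2 * sumon b X + sumon (net h) X.
  by rewrite /sumon !mulr_sumr -big_split /=; apply: eq_bigr => v _; case: (uE v).
have netX (X : {set V}) : `|sumon (net h) X| <= cutz g X.
  rewrite sumon_net -(reor_cutz X gh); apply: le_trans (ler_norm_sum _ _ _) _.
  by apply: ler_sum => e _; rewrite /crosses; case: (_ \in X); case: (_ \in X).
have smnet0 : sumon (net h) setT = 0 by have := netX setT; rewrite cutzT; clear; lia.
have par (X : {set V}) : exists l : int, cutz g X = sumon u X + 2 * l.
  have [l lE] := sum_cut1 g X.
  suff [l' l'E] : exists l', sumon u X = \sum_(v in X) cutz g [set v] + 2 * l'.
    by exists (- l - l'); move: lE l'E; clear; lia.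
  exists (\sum_(v in X) ((u v - cutz g [set v]) %/ 2)%Z).
  rewrite /sumon mulr_sumr -big_split /=; apply: eq_bigr => v _.
  have [_ [l' ->]] := uE v.
  by rewrite addrAC subrr add0r (mulrC 2 l') mulzK // mulrC.
have [||o [go on]] := @orientation_with_net V E g u _ _ par.
- have := smu setT; rewrite b0 smnet0 mulr0 addr0 => /eqP.
  by rewrite mulf_eq0 => /orP[/eqP|/eqP //]; move: m0; clear; lia.
(* With [d] the size of the cut, [m * sumon u X] is at most [2k d + 4k + d = m d + 4k], less than
   [m (d + 2)]; parity improves [sumon u X < d + 2] to the cut condition. *)
- move=> X; have [l lE] := par X.
  have : m * sumon u X < m * (cutz g X + 2).
    by rewrite smu; move: (bX X) (netX X) (cutz_ge0 g X); rewrite /m; clear; lia.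
  by rewrite ltr_pM2l // lE; clear; lia.
pose O e : int := if o e == g e then 1 else -1.
pose f e := if (o e == g e) == (h e == g e) then k%:Z * O e else (k%:Z + 1) * O e.
exists f; split.
  by move=> e; rewrite /f /O; case: (o e == g e); case: (h e == g e) => /=; clear; lia.
move=> v; apply: (@mulfI _ 2%:Z) => //.
have -> : 2 * b v = m * net o v - net h v by rewrite on; have [-> _] := uE v; clear; lia.
rewrite /net !mulr_sumr -sumrB; apply: eq_bigr => e _; rewrite /f /O /m.
case: (o e =P g e) => [->|no]; case: (h e =P g e) => [->|nh] /=; last 1 first.
- by have [//|->] := go e; have [//|->] := gh e; rewrite /=; clear; lia.
- by clear; lia.
- by have [//|->] := gh e; rewrite /=; clear; lia.
- by have [//|->] := go e; rewrite /=; clear; lia.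
Qed.

(** The orientation is fixed, positive edges running from first to second end and negative ones
    being sink edges; the sign of [f] carries the choice. The negative edges get values first and
    their boundary becomes the demand on the positive ones. *)
Lemma integer_flow (V E : finType) (g : E -> V * V) (sigma : E -> bool) (k : nat) (v0 : V) :
  let gP := pos_graph g sigma in
  (0 < k)%N ->
  (forall X : {set V}, X != set0 -> X != setT -> 6 * k%:Z <= cutz gP X) ->
  ~~ odd #|[set e | sigma e]| \/ (2 * k + 1 <= #|[set e | sigma e]|)%N ->
  exists f : E -> int, (forall e, `|f e| = k%:Z \/ `|f e| = k%:Z + 1) /\
    forall v, \sum_e f e * (indz ((g e).1 == v) + (if sigma e then indz ((g e).2 == v)
       else - indz ((g e).2 == v))) = 0.
Proof.
move=> gP k0 cut Nk.
have cut4 (X : {set V}) : X != set0 -> X != setT -> 4 <= cutz gP X.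
  by move=> X0 XT; have := cut X X0 XT; move: k0; clear; lia.
have [c [c1 c0 cX]] := negative_values v0 cut4 Nk.
pose b v := - \sum_(e | sigma e) c e * (indz ((g e).1 == v) + indz ((g e).2 == v)).
have bE (X : {set V}) : sumon b X = - \sum_(e | sigma e) c e * ends_in g X e.
  rewrite /sumon sumrN exchange_big /=; congr (- _); apply: eq_bigr => e _.
  by rewrite -mulr_sumr big_split /= !sum_in_indz.
have [||p [p1 pE]] := positive_values k0 cut (b := b).
- rewrite bE (eq_bigr (fun e => c e * 2)) => [|e _]; last by rewrite /ends_in !inE.
  by rewrite -mulr_suml c0 mul0r oppr0.
- by move=> X; rewrite bE normrN.
exists (fun e => if sigma e then c e else p e); split; first by move=> e; case: (sigma e).
move=> v; have := pE v; rewrite /b => pv.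
transitivity (\sum_e p e * (indz ((gP e).1 == v) - indz ((gP e).2 == v))
  + \sum_(e | sigma e) c e * (indz ((g e).1 == v) + indz ((g e).2 == v))); last first.
  by rewrite pv addNr.
rewrite [X in _ = _ + X]big_mkcond -big_split /=; apply: eq_bigr => e _.
by rewrite /gP /pos_graph; case: (sigma e) => /=; rewrite ?subrr ?mulr0 ?add0r ?addr0.
Qed.

(** * Switching *)

Definition switched (V E : finType) (ends : E -> V * V) (sigma : E -> bool) (X : {set V}) :=
  foldr (switch_at ends) sigma (enum X).

Lemma switchedE (V E : finType) (ends : E -> V * V) (sigma : E -> bool) (X : {set V}) e :
  switched ends sigma X e = sigma e (+) ((ends e).1 \in X) (+) ((ends e).2 \in X).
Proof.
rewrite /switched -!(mem_enum X); have := enum_uniq X; elim: (enum X) => [|v s IH] /=.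
  by rewrite !addbF.
case/andP=> vs us; rewrite /switch_at IH // !inE.
have mem_or u : (u == v) || (u \in s) = (u == v) (+) (u \in s).
  by case: eqP => [->|//]; rewrite (negPf vs).
rewrite !mem_or; case: (sigma e); case: (_ == v); case: (_ == v);
  by case: (_ \in s); case: (_ \in s).
Qed.

(* With fewest negative edges, switching on Y cannot gain anything. *)
Lemma min_switched (V E : finType) (ends : E -> V * V) (sigma : E -> bool) :
  exists X : {set V}, forall Y : {set V},
    cutz ends Y <= 2 * cutz (pos_graph ends (switched ends sigma X)) Y.
Proof.
pose neg X := #|[set e | switched ends sigma X e]|.
case: (@arg_minnP _ set0 xpredT neg isT) => X _ Xmin; exists X => Y.
pose X' := [set v | (v \in X) (+) (v \in Y)].
have := Xmin X' isT; rewrite -lez_nat /neg !card_sum_indz => le.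
pose cr e := ((ends e).1 \in Y) != ((ends e).2 \in Y).
set s := switched ends sigma X in le *.
have E1 : \sum_e indz (e \in [set e0 | switched ends sigma X' e0])
   = \sum_e indz (s e) + cutz ends Y - 2 * \sum_e indz (s e && cr e).
  rewrite /cutz mulr_sumr -big_split -sumrB /=; apply: eq_bigr => e _.
  rewrite inE !switchedE !inE /s switchedE /crosses /cr.
  by case: (sigma e); case: ((ends e).1 \in X); case: ((ends e).2 \in X);
     case: ((ends e).1 \in Y); case: ((ends e).2 \in Y).
have E2 : cutz (pos_graph ends s) Y = cutz ends Y - \sum_e indz (s e && cr e).
  rewrite /cutz -sumrB /=; apply: eq_bigr => e _; rewrite /pos_graph /cr.
  by case: (s e); rewrite ?crosses_loop /= ?subrr // subr0.
have E3 : \sum_e indz (e \in [set e0 | s e0]) = \sum_e indz (s e).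
  by apply: eq_bigr => e _; rewrite inE.
by move: le; rewrite E1 E2 E3; clear; lia.
Qed.

Unset Implicit Arguments.
Set Printing Implicit Defensive.

Theorem theorem1 (R : realType) (V E : finType) (ends : E -> V * V)
  (sigma : E -> bool) (k : nat) :
  (0 < k)%N ->
  edge_connected ends (12 * k - 1) ->
  essentially_unbalanced ends sigma (2 * k + 1) ->
  Phi_c_le ends sigma (2 + (k%:R)^-1 : R).
Proof.
move=> k0 conn unb; exists (2 + (k%:R)^-1); split=> //.
case: (pickP (fun v : V => true)) => [v0 _|V0]; last first.
  exists (fun=> (true, true)), (fun=> 0); split; first split.
  - by move=> e; have := V0 (ends e).1.
  - by move=> v; have := V0 v.
  - by move=> e; have := V0 (ends e).1.
have [X half] := min_switched ends sigma.
set s := switched ends sigma X in half.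
have cut6 (Y : {set V}) : Y != set0 -> Y != setT ->
    6 * k%:Z <= cutz (pos_graph ends s) Y.
  (* Half of [12 * k - 1], rounded up, is [6 * k]. *)
  move=> Y0 YT; have := conn Y Y0 YT; have := half Y.
  by rewrite [cutz ends Y]cutz_card -/(cut ends Y); move: k0; clear; lia.
have Nk : ~~ odd #|[set e | s e]| \/ (2 * k + 1 <= #|[set e | s e]|)%N.
  by apply: unb; exists (enum X).
have [F [F1 F0]] := integer_flow v0 k0 cut6 Nk.
have kR : (k%:R : R) != 0 by rewrite pnatr_eq0 -lt0n.
(* Switching back on [X] reverses every edge end at a vertex of [X], which negates the boundary
   there. *)
exists (fun e => (~~ ((ends e).1 \in X), s e (+) ((ends e).2 \in X))).
exists (fun e => (F e)%:~R / k%:R); split; first split.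
- move=> e /=; rewrite /s switchedE.
  by case: (sigma e); case: ((ends e).1 \in X); case: ((ends e).2 \in X).
- move=> v; rewrite /boundary.
  transitivity ((if v \in X then -1 else 1) / k%:R *
    ((\sum_e F e * (indz ((ends e).1 == v) + (if s e then indz ((ends e).2 == v)
       else - indz ((ends e).2 == v))))%:~R) : R); last by rewrite F0 mulr0.
  rewrite rmorph_sum /= mulr_sumr; apply: eq_bigr => e _.
  rewrite rmorphM rmorphD /=.
  case: ((ends e).1 =P v) => [->|_]; case: ((ends e).2 =P v) => [->|_];
    case: (v \in X); case: (s e); rewrite /= ?rmorphN ?indzT ?indzF /=; ring.
- move=> e; rewrite normrM normfV normr_nat -intr_norm.
  have k1 : (0 : R) < k%:R by rewrite ltr0n.
  have -> : 2 + k%:R^-1 - 1 = ((k%:Z + 1)%:~R / k%:R : R).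
    by rewrite rmorphD /= mulrDl -pmulrn divff // mul1r; ring.
  rewrite ler_pdivlMr // mul1r ler_pM2r ?invr_gt0 // pmulrn !ler_int.
  by have := F1 e; clear; lia.
Qed.
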